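(* Let $g,n\ge0$ be integers with $2g-2+n>0$. Then $$\frac{\partial}{\partial\kappa}\chi_{g,n}=\frac12\Big(DD\chi_{g-1,n}+\sum_{\substack{g_1+g_2=g\\ n_1+n_2=n}}D\chi_{g_1,n_1}\cdot D\chi_{g_2,n_2}\Big).$$ In particular, for $n=0$ and $g\ge2$, $$\frac{\partial}{\partial\kappa}\chi_{g,0}=\frac12\Big(Dd\chi_{g-1,0}+\sum_{r=1}^{g-1}d\chi_{r,0}\cdot d\chi_{g-r,0}\Big).$$ Here the unstable terms are interpreted by the conventions $d\chi_{1,0}=D\chi_{1,0}:=\chi_{1,1}$, $D\chi_{0,2}:=3\chi_{0,3}$, $DD\chi_{0,1}:=6\chi_{0,3}$, and all other unstable terms ($D\chi_{0,0}$, $D\chi_{0,1}$ in the sum, and any term with a negative genus) are zero.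
   Context: Stable graphs: a stable graph is a finite graph (loops and multiple edges allowed) with internal edges, each joining two (possibly equal) vertices, and unlabelled external edges, each attached to one vertex. Each vertex $v$ carries a genus $g_v\in\mathbb Z_{\ge0}$; its valence $\mathrm{val}_v$ is the number of half-edges at $v$ (an external edge counts once, a loop twice); stability means $2g_v-2+\mathrm{val}_v>0$ for every $v$. The genus of a connected stable graph $\Gamma$ is $h^1(\Gamma)+\sum_v g_v$. $\mathcal G^c_{g,n}$ is the (finite) set of isomorphism classes of connected stable graphs of genus $g$ with $n$ external edges, $V(\Gamma)$ and $E(\Gamma)$ are the sets of vertices and internal edges, and $\mathrm{Aut}(\Gamma)$ is the automorphism group (acting on vertices and half-edges; external edges may be permuted). For $2g-2+n>0$, $\chi(\mathcal M_{g,n})$ is the orbifold Euler characteristic of the moduli space of smooth genus $g$ curves with $n$ marked points, given by the Harer–Zagier formula $\chi(\mathcal M_{g,n})=(-1)^n\frac{(2g-1)B_{2g}}{(2g)!}(2g+n-3)!$. With $t,\kappa$ independent formal variables, $$\chi_{g,n}(t,\kappa):=\sum_{\Gamma\in\mathcal G^c_{g,n}}\frac{\kappa^{|E(\Gamma)|}}{|\mathrm{Aut}(\Gamma)|}\prod_{v\in V(\Gamma)}\chi(\mathcal M_{g_v,\mathrm{val}_v})\,t^{2-2g_v-\mathrm{val}_v}.$$ The operator $d:=\frac{\partial}{\partial t}+\kappa^2t^{-1}\frac{\partial}{\partial\kappa}$, and $D$ acts on an expression attached to graphs with $m$ external edges (such as $\chi_{h,m}$) by $D=d+m\,\kappa t^{-1}$.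 Applying $D$ raises the number of external edges by one; thus in $DD\chi_{h,m}$ the first application uses $m$ external edges and the second uses $m+1$ (and $DD\chi_{0,2}$, $DD\chi_{1,0}$ mean $D(3\chi_{0,3})$, $D(\chi_{1,1})$). *)

(* Defs.v *)
From HB Require Import structures.
From mathcomp Require Import all_boot all_order all_algebra all_fingroup generic_quotient.
From mathcomp Require Import boolp classical_sets cardinality fsbigop.
From mathcomp Require Import ring zify.

Set Implicit Arguments.
Unset Strict Implicit.
Unset Printing Implicit Defensive.
Import GRing.Theory.
Local Open Scope ring_scope.
Local Open Scope quotient_scope.

(* An involution on the half-edges encodes the edges: a fixed half-edge is an
   external edge, a 2-cycle is an internal edge (a loop when both halves have
   the same root). *)
Record graph (V H : finType) := Graph {
  vgenus : V -> nat;
  root : H -> V;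
  flip : H -> H;
  flipK : involutive flip }.

Section Graph.
Variables (V H : finType) (G : graph V H).

Definition valence (v : V) : nat := #|[set h | root G h == v]%SET|.

Definition external : {set H} := [set h | flip G h == h]%SET.

Definition edges : {set {set H}} :=
  [set [set h; flip G h] | h in ~: external]%SET.

Definition adj : rel V :=
  fun v w => [exists h, (root G h == v) && (root G (flip G h) == w)].

Definition components : nat := n_comp adj V.

(* In particular the empty graph is not connected. *)
Definition connected : bool := components == 1%N.

Definition stable : bool := [forall v, (2 < 2 * vgenus G v + valence v)%N].

Definition betti1 : int := #|edges|%:Z - #|V|%:Z + components%:Z.

Definition graph_genus : int := betti1 + (\sum_v vgenus G v)%:Z.

End Graph.

Definition is_iso (V1 H1 V2 H2 : finType)
    (G1 : graph V1 H1) (G2 : graph V2 H2) (f : V1 -> V2) (k : H1 -> H2) : Prop :=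
  [/\ bijective f, bijective k,
      forall v, vgenus G2 (f v) = vgenus G1 v,
      forall h, root G2 (k h) = f (root G1 h) &
      forall h, flip G2 (k h) = k (flip G1 h)].

Definition isomorphic (V1 H1 V2 H2 : finType)
    (G1 : graph V1 H1) (G2 : graph V2 H2) : Prop :=
  exists f k, is_iso G1 G2 f k.

Definition Aut (V H : finType) (G : graph V H) : {set {perm V} * {perm H}} :=
  [set p : {perm V} * {perm H} | `[< is_iso G G p.1 p.2 >]]%SET.

(* Every graph is isomorphic to one whose vertices and half-edges are
   ordinals, so these suffice to form the set of isomorphism classes. *)
Record ord_graph := OrdGraph {
  nv : nat;
  nh : nat;
  to_graph :> graph 'I_nv 'I_nh }.

HB.instance Definition _ := gen_eqMixin ord_graph.
HB.instance Definition _ := gen_choiceMixin ord_graph.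

Definition isob : rel ord_graph := fun G1 G2 => `[< isomorphic G1 G2 >].

Lemma isomorphic_refl (V H : finType) (G : graph V H) : isomorphic G G.
Proof. by exists id, id; split=> //; exists id. Qed.

Lemma isomorphic_sym (V1 H1 V2 H2 : finType)
  (G1 : graph V1 H1) (G2 : graph V2 H2) : isomorphic G1 G2 -> isomorphic G2 G1.
Proof.
move=> [f [k [[f' fK f'K] [k' kK k'K] eg er ef]]].
exists f', k'; split.
- by exists f.
- by exists k.
- by move=> v; rewrite -{2}[v]f'K eg.
- by move=> h; rewrite -{2}[h]k'K er fK.
- by move=> h; rewrite -{2}[h]k'K ef kK.
Qed.

Lemma isomorphic_trans (V1 H1 V2 H2 V3 H3 : finType)
    (G1 : graph V1 H1) (G2 : graph V2 H2) (G3 : graph V3 H3) :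
  isomorphic G1 G2 -> isomorphic G2 G3 -> isomorphic G1 G3.
Proof.
move=> [f [k [bf bk eg er ef]]] [f' [k' [bf' bk' eg' er' ef']]].
exists (f' \o f), (k' \o k); split; try exact: bij_comp.
- by move=> v; rewrite /= eg' eg.
- by move=> h; rewrite /= er' er.
- by move=> h; rewrite /= ef' ef.
Qed.

Lemma isob_refl : reflexive isob.
Proof. by move=> G; apply/asboolP/isomorphic_refl. Qed.

Lemma isob_sym : symmetric isob.
Proof. by move=> G1 G2; apply/asboolP/asboolP; apply: isomorphic_sym. Qed.

Lemma isob_trans : transitive isob.
Proof.
move=> G2 G1 G3 /asboolP i12 /asboolP i23.
exact/asboolP/(isomorphic_trans i12 i23).
Qed.

Canonical isob_equiv := EquivRel isob isob_refl isob_sym isob_trans.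

Definition graph_class := {eq_quot isob}.
HB.instance Definition _ := EqQuotient.on graph_class.
HB.instance Definition _ := Choice.on graph_class.

Definition stable_classes (g n : nat) : set graph_class :=
  [set x | exists G : ord_graph,
     [/\ x = \pi_graph_class G, connected G, stable G,
         graph_genus G = g & #|external G| = n]]%classic.

Lemma sum_valence (V H : finType) (G : graph V H) :
  (\sum_v valence G v = #|H|)%N.
Proof.
rewrite -sum1_card (partition_big (root G) predT) //=.
by apply: eq_bigr => v _; rewrite /valence -sum1_card; apply: eq_bigl => h; rewrite inE.
Qed.

Lemma card_half_edges (V H : finType) (G : graph V H) :
  #|H| = (#|external G| + 2 * #|edges G|)%N.
Proof.
rewrite -(cardsC (external G)); congr addn.
rewrite -sum1_card (partition_big_imset (fun h => [set h; flip G h]%SET)) /=.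
rewrite mulnC -sum_nat_const; apply: eq_bigr => _ /imsetP[h hE ->].
transitivity #|[set h; flip G h]%SET|.
  rewrite -sum1_card; apply: eq_bigl => k; apply/andP/idP.
    by move=> [_ /eqP <-]; rewrite !inE eqxx.
  move: hE; rewrite !inE => hE /orP[]/eqP->; split=> //.
    by rewrite flipK eq_sym.
  by rewrite flipK finset.setUC.
by move: hE; rewrite !inE cards2 eq_sym => ->.
Qed.

Lemma finite_stable_classes g n : finite_set (stable_classes g n).
Proof.
pose M := (6 * g + 3 * n).+1.
pose data := {v : 'I_M & {h : 'I_M &
  {ffun 'I_v -> 'I_M} * {ffun 'I_h -> 'I_v} * {ffun 'I_h -> 'I_h}}%type}.
have e0 : @involutive 'I_0 id by [].
pose G0 := OrdGraph (@Graph 'I_0 'I_0 (fun=> 0%N) id id e0).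
pose F (x : data) : graph_class :=
  let: existT v (existT h (a, b, c)) := x in
  match pselect (involutive c) with
  | left cK => \pi_graph_class (OrdGraph (Graph (fun v => val (a v)) b cK))
  | right _ => \pi_graph_class G0
  end.
apply: (@sub_finite_set _ _ (F @` [set: data])%classic); last first.
  exact/finite_image/finite_finset.
move=> _ [G [-> /eqP Gc /forallP Gs Gg Gn]] /=.
have hH := card_half_edges G; have hV := sum_valence G.
move: Gg; rewrite /graph_genus /betti1 Gc !card_ord => Gg.
rewrite Gn card_ord in hH; rewrite card_ord in hV.
have hs : (\sum_(v < nv G) 3 <= 2 * (\sum_v vgenus G v) + nh G)%N.
  apply: (@leq_trans (\sum_v (2 * vgenus G v + valence G v))%N).
    by apply: leq_sum => v _; exact: Gs.
  by rewrite big_split -big_distrr /= hV.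
rewrite sum_nat_const card_ord in hs.
have vM : (nv G < M)%N by rewrite /M; lia.
have hM : (nh G < M)%N by rewrite /M; lia.
have sM : (\sum_v vgenus G v < M)%N by rewrite /M; lia.
have gM v : (vgenus G v < M)%N by apply: leq_ltn_trans sM; by rewrite (bigD1 v) //= leq_addr.
clear hs sM Gg hV hH Gn Gs Gc.
case: G vM hM gM => v h [a b c cK] /= vM hM gM.
exists (existT _ (Ordinal vM) (existT _ (Ordinal hM)
   ([ffun i => Ordinal (gM i)], [ffun i => b i], [ffun i => c i]))) => //=.
case: pselect => [cK'|[]]; last by move=> i; rewrite !ffunE cK.
congr \pi_graph_class; congr OrdGraph.
have /= aE : (fun i => val ([ffun i => Ordinal (gM i)] i)) = a.
  by apply/funext => i; rewrite ffunE.
have bE : [ffun i => b i] = b :> ('I_h -> 'I_v) by apply/funext => i; rewrite ffunE.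
have cE : [ffun i => c i] = c :> ('I_h -> 'I_h) by apply/funext => i; rewrite ffunE.
move: cK'; rewrite /= aE bE cE => cK'.
by congr Graph; exact: Prop_irrelevance.
Qed.

(* [:: B_0; ...; B_(n-1)], from \sum_(k <= m) 'C(m+1, k) B_k = (m == 0). *)
Fixpoint bernoulli_seq (n : nat) : seq rat :=
  if n is m.+1 then
    let s := bernoulli_seq m in
    rcons s (((m == 0%N)%:R - \sum_(k < m) 'C(m.+1, k)%:R * s`_k) / m.+1%:R)
  else [::].

Definition bernoulli (n : nat) : rat := (bernoulli_seq n.+1)`_n.

Lemma size_bernoulli_seq n : size (bernoulli_seq n) = n.
Proof. by elim: n => //= n IHn; rewrite size_rcons IHn. Qed.

Lemma bernoulli_seqE n k : (k < n)%N -> (bernoulli_seq n)`_k = bernoulli k.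
Proof.
elim: n => // n IHn; rewrite ltnS leq_eqVlt => /predU1P[-> //|lt_kn].
by rewrite /= nth_rcons size_bernoulli_seq lt_kn IHn.
Qed.

Lemma bernoulli_rec n :
  \sum_(k < n.+1) 'C(n.+1, k)%:R * bernoulli k = (n == 0%N)%:R.
Proof.
rewrite big_ord_recr /= {2}/bernoulli /= nth_rcons size_bernoulli_seq ltnn eqxx.
rewrite binSn mulrC divfK ?Num.Theory.pnatr_eq0 //.
under [X in _ + (_ - X)]eq_bigr do rewrite bernoulli_seqE //.
by rewrite addrC subrK.
Qed.

(* The Harer-Zagier formula; meaningful for 2 < 2 * g + n only. *)
Definition chiM (g n : nat) : rat :=
  (-1) ^+ n * ((2 * g)%:R - 1) * bernoulli (2 * g) / (2 * g)`!%:R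
  * (2 * g + n - 3)`!%:R.

(* The formal variables live in Q(t)[kappa]; this contains the ring
   Q[t, t^-1, kappa] in which all the expressions take their values. *)
Definition Qt : fieldType := {fraction {poly rat}}.
Notation Qtk := {poly Qt}.

Definition tvar : Qt := FracField.tofrac ('X : {poly rat}).
Definition kappa : Qtk := 'X.

(* d/dt by the quotient rule, applied to a chosen numerator and denominator;
   see [dfrac_div] for the independence from that choice. *)
Definition dfrac (x : Qt) : Qt :=
  let p : {poly rat} := \n_(repr x) in
  let q : {poly rat} := \d_(repr x) in
  FracField.tofrac (p^`() * q - p * q^`()) / FracField.tofrac (q ^+ 2).

Lemma dfrac_div (p q : {poly rat}) : q != 0 ->
  dfrac (FracField.tofrac p / FracField.tofrac q) =
  FracField.tofrac (p^`() * q - p * q^`()) / FracField.tofrac (q ^+ 2).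
Proof.
move=> q0; rewrite /dfrac; set x : Qt := FracField.tofrac p / FracField.tofrac q.
set p' := \n_(repr x); set q' := \d_(repr x).
have q'0 : q' != 0 by exact: denom_ratioP.
have tofrac_neq0 (r : {poly rat}) : r != 0 -> FracField.tofrac r != 0.
  by rewrite tofrac_eq0.
have xE : x = FracField.tofrac p' / FracField.tofrac q'.
  apply: (canRL (mulfK (tofrac_neq0 _ q'0))).
  rewrite -[x in LHS]reprK -[LHS]/(FracField.mul _ _) !piE /FracField.mulf.
  apply/eqmodP; rewrite /= FracField.equivfE.
  by rewrite !numden_Ratio ?mulf_neq0 ?oner_eq0// !mulr1 mulrC.
have E : p * q' = p' * q.
  apply/eqP; rewrite -tofrac_eq !tofracM; apply/eqP.
  have := xE; rewrite /x => /eqP.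
  by rewrite eqr_div ?tofrac_neq0// => /eqP.
have dE : p^`() * q' + p * q'^`() = p'^`() * q + p' * q^`().
  by rewrite -!derivM E.
apply/eqP; rewrite eqr_div ?tofrac_neq0 ?expf_neq0// -!tofracM tofrac_eq.
apply/eqP; transitivity
  (q * q' * (p^`() * q' + p * q'^`()) - p * q' * (q * q'^`() + q^`() * q')).
  by rewrite dE E; ring.
by ring.
Qed.

Definition d_t (f : Qtk) : Qtk := map_poly dfrac f.
Definition d_kappa (f : Qtk) : Qtk := f^`().

Definition dop (f : Qtk) : Qtk := d_t f + tvar^-1 *: (kappa ^+ 2 * d_kappa f).

(* D on an expression attached to graphs with m external edges. *)
Definition Dop (m : nat) (f : Qtk) : Qtk := dop f + (m%:R / tvar) *: (kappa * f).

Definition vertex_weight (g n : nat) : Qt :=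
  ratr (chiM g n) * tvar ^ (2 - 2 * g%:Z - n%:Z).

Definition graph_weight (V H : finType) (G : graph V H) : Qtk :=
  (#|Aut G|%:R^-1 * \prod_v vertex_weight (vgenus G v) (valence G v))
    *: kappa ^+ #|edges G|.

(* The sum over an infinite support would be 0 by convention; the support is
   finite by [finite_stable_classes]. *)
Definition chi (g n : nat) : Qtk :=
  \sum_(x \in stable_classes g n) graph_weight (repr x : ord_graph).

(* [dchi], [Dchi] and [DDchi] are d chi_(g,0), D chi_(g,n) and D D chi_(g,n)
   with their conventions for unstable (g, n). *)
Definition dchi (g : nat) : Qtk := if g == 1%N then chi 1 1 else dop (chi g 0).

Definition Dchi (g n : nat) : Qtk :=
  match g, n with
  | 0%N, 0%N | 0%N, 1%N => 0
  | 0%N, 2%N => chi 0 3 *+ 3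
  | 1%N, 0%N => chi 1 1
  | _, _ => Dop n (chi g n)
  end.

Definition DDchi (g n : nat) : Qtk :=
  match g, n with
  | 0%N, 1%N => chi 0 3 *+ 6
  | _, _ => Dop n.+1 (Dchi g n)
  end.

(* Main.v *)
Require Import Defs.
From HB Require Import structures.
From mathcomp Require Import all_boot all_order all_algebra.
From mathcomp Require Import all_fingroup generic_quotient finmap.
From mathcomp Require Import boolp classical_sets cardinality fsbigop.
From mathcomp Require Import ring zify.
Import Defs.
Import GRing.Theory.
Set Implicit Arguments.
Unset Strict Implicit.
Unset Printing Implicit Defensive.
Local Open Scope ring_scope.

(** The automorphism factors disappear once vertices and half-edges carry
    labels. For a graph with v vertices and h half-edges, v! h! / |Aut| is the
    number of its labellings, so the sum over isomorphism classes weighted by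
    1 / |Aut| is the sum over all graphs on 'I_v and 'I_h, divided by v! h!
    ([chi_total]). On labelled graphs each identity below is a bijection
    between graphs with marked half-edges, and a product of two series is a
    choice of the labels that go to each factor.

    The operator D marks an external edge: D chi_(g,n) = (n+1) chi_(g,n+1)
    ([Dop_chi]). Let l be a marked external edge of a graph of type (g,n+1).
    If the vertex v carrying l is still stable without l, the graph comes from
    one of type (g,n) by attaching l at v ([add_leg]). Since
    chi(M_(g,n+1)) = (2-2g-n) chi(M_(g,n)), the sum over v is the Leibniz rule
    for d/dt. Otherwise v has genus 0 and carries l and two further half-edges,
    at least one of them on an edge that leaves v: all other possibilities
    make v the whole graph and (g,n) unstable. Removing v leaves a graph of
    type (g,n) with a chosen half-edge c ([insert_vertex]); the internal c give
    kappa^2 t^-1 d/dkappa and the external ones give n kappa / t.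

    The derivative in kappa marks an internal edge. Cutting it leaves a graph
    with two distinguished external edges c and d ([d_kappa_total]). If it is
    connected its genus has dropped by one, which gives
    (n+2)(n+1) chi_(g-1,n+2) ([glued_sum_connected]). If not, it is in exactly
    one way the disjoint union of a graph carrying c and a graph carrying d
    ([count_separations], [glued_sum_union]), which gives the sum of the
    products (n1+1) chi_(g1,n1+1) (n2+1) chi_(g2,n2+1). Each edge has been cut
    twice, once for each order of c and d, whence the factor 1/2.

    By the first part these terms are D D chi_(g-1,n) and the products
    D chi_(g1,n1) D chi_(g2,n2). The unstable conventions are the values that
    make D chi_(g,n) = (n+1) chi_(g,n+1) hold for all g and n ([DchiE]),
    because chi_(0,1) = chi_(0,2) = 0. *)

(** * Finite sums and reachability *)

Lemma sum_bij (R : nmodType) (I J : finType) (P : pred I) (Q : pred J)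
    (F : I -> R) (psi : J -> I) :
  {in Q &, injective psi} -> (forall j, Q j -> P (psi j)) ->
  (forall i, P i -> exists2 j, Q j & psi j = i) ->
  \sum_(i | P i) F i = \sum_(j | Q j) F (psi j).
Proof.
move=> psiI QP PQ.
transitivity (\sum_(i in psi @: [set j | Q j]%SET) F i).
  apply: eq_bigl => i; apply/idP/imsetP.
    by move=> /PQ[j Qj <-]; exists j; rewrite ?inE.
  by move=> [j]; rewrite inE => Qj ->; exact: QP.
rewrite big_imset /=; first by apply: eq_bigl => j; rewrite inE.
by move=> j j'; rewrite !inE; exact: psiI.
Qed.

Lemma connect_homo (T T' : finType) (e : rel T) (e' : rel T') (f : T -> T') :
  (forall x y, e x y -> connect e' (f x) (f y)) ->
  forall x y, connect e x y -> connect e' (f x) (f y).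
Proof.
move=> ef x y /connectP[p].
elim: p x => [|z p IHp] x /=; first by move=> _ ->.
by move=> /andP[/ef xz] /IHp/[apply]; apply: connect_trans.
Qed.

(** * Connected and stable graphs *)

Section Basics.
Variables (V H : finType).
Implicit Types G : graph V H.

Lemma graph_eq G G' : vgenus G =1 vgenus G' -> root G =1 root G' ->
  flip G =1 flip G' -> G = G'.
Proof.
case: G G' => a r s sK [a' r' s' sK'] /= /funext ea /funext er /funext es.
by subst; congr Graph; exact: Prop_irrelevance.
Qed.

Lemma adj_sym G : symmetric (adj G).
Proof.
move=> v w; apply/existsP/existsP => -[h /andP[/eqP <- /eqP <-]];
  by exists (flip G h); rewrite flipK !eqxx.
Qed.

Lemma connect_adj_sym G : connect_sym (adj G).
Proof. exact/sym_connect_sym/adj_sym. Qed.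

Lemma adj_root G h : adj G (root G h) (root G (flip G h)).
Proof. by apply/existsP; exists h; rewrite !eqxx. Qed.

Lemma connectedP G :
  reflect (exists v, forall w, connect (adj G) v w) (connected G).
Proof.
have symG := connect_adj_sym G.
apply: (iffP idP) => [|[v cv]].
  rewrite /connected /components /n_comp_mem => /eqP/mem_card1[v /= vP].
  exists v => w; rewrite symG.
  have := vP (fingraph.root (adj G) w).
  rewrite !inE andbT roots_root // => /esym/eqP <-.
  exact: connect_root.
rewrite /connected /components -(n_comp_connect symG v).
by apply/eqP/eq_n_comp_r => w; rewrite -[RHS]/(connect _ v w) cv.
Qed.

(** The usual form of connectedness in arguments by propagation: a nonempty set
    of vertices that no edge leaves is everything. *)
Lemma connected_closed G (A : {set V}) v : connected G -> v \in A ->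
  (forall h, root G h \in A -> root G (flip G h) \in A) -> A = [set: V]%SET.
Proof.
move=> /connectedP[u cu] vA clA; apply/setP => w; rewrite inE.
have cl : closed (adj G) A.
  move=> x y /existsP[h /andP[/eqP <- /eqP <-]].
  by apply/idP/idP => [|/clA]; [exact: clA|rewrite flipK].
have cvw : connect (adj G) v w.
  by apply: connect_trans (cu w); rewrite connect_adj_sym.
by rewrite -(closed_connect cl cvw).
Qed.

(** The inequality |V| <= |E| + 1, that is h^1 >= 0, with 2 |E| written as the
    number of half-edges that are not external. It makes the genus of a
    connected graph a natural number, which is needed for the graphs obtained
    by cutting. The proof grows a set of vertices from v0, each new vertex
    bringing a new edge. *)
Lemma spanning_tree_bound G :
  connected G -> (2 * #|V| + #|external G| <= #|H| + 2)%N.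
Proof.
move=> cG; have [v0 _] := connectedP _ cG.
pose inner (A : {set V}) :=
  [set h | [&& flip G h != h, root G h \in A & root G (flip G h) \in A]]%SET.
pose P (A : {set V}) := (v0 \in A) && (2 * #|A| <= #|inner A| + 2)%N.
have P0 : P [set v0]%SET by rewrite /P set11 cards1; lia.
(* A largest A with enough inner edges for a tree is the whole of V: a
   half-edge h leaving A would allow adding its far end w. *)
case: (@arg_maxnP _ _ P (fun A => #|A|) P0) => A /andP[v0A bA] maxA.
have AT : A = [set: V]%SET.
  apply: (connected_closed cG v0A) => h hA; apply: contraT => hnA.
  have hx : flip G h != h by apply: contraNneq hnA => ->.
  pose w := root G (flip G h).
  have PA' : P (w |: A)%SET.
    rewrite /P !inE v0A orbT cardsU1 hnA /=.
    have : (#|flip G h |: (h |: inner A)|%SET <= #|inner (w |: A)%SET|)%N.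
      apply/subset_leq_card/fintype.subsetP => x; rewrite !inE.
      move=> /orP[/eqP->|/orP[/eqP->|/and3P[-> -> ->]]].
      - by rewrite flipK eqxx hA orbT eq_sym hx.
      - by rewrite hx hA eqxx orbT.
      - by rewrite !orbT.
    rewrite !cardsU1 !inE flipK (negbTE hnA) (negbTE hx) /= !andbF /=; lia.
  by have := maxA _ PA'; rewrite cardsU1 hnA; lia.
move: bA; rewrite AT cardsT -(cardsC (external G)).
have -> : inner [set: V]%SET = (~: external G)%SET.
  by rewrite /inner; apply/setP => h; rewrite !inE !andbT.
lia.
Qed.

(** The genus condition avoids subtraction and edges: as 2 |E| = |H| - n, it is
    twice the equation |E| - |V| + 1 + (sum of the genera) = g. It thus depends
    on the graph only through |V|, |H|, n and the vertex genera, which are easy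
    to follow through the constructions below. *)
Definition of_type (g n : nat) G : bool :=
  [&& connected G, stable G, #|external G| == n &
      2 * (\sum_v vgenus G v) + #|H| + 2 == 2 * g + 2 * #|V| + n]%N.

Lemma of_typeP (g n : nat) G : reflect
  [/\ connected G, stable G, graph_genus G = g & #|external G| = n]
  (of_type g n G).
Proof.
have hH := card_half_edges G.
apply: (iffP and4P) => [[cG sG /eqP eG /eqP gG]|[cG sG gG eG]]; split=> //.
- by move: cG => /eqP cG; rewrite /graph_genus /betti1 cG; lia.
- exact/eqP.
- by move: gG; rewrite /graph_genus /betti1 (eqP cG); lia.
Qed.

Lemma leq_stable G : stable G ->
  (3 * #|V| <= 2 * (\sum_v vgenus G v) + #|H|)%N.
Proof.
move=> /forallP sG; rewrite -(sum_valence G) big_distrr /= -big_split /=.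
by rewrite mulnC -sum_nat_const; apply: leq_sum => v _; exact: sG.
Qed.

(** Stability gives 3 |V| <= 2 (sum of the genera) + |H|; with the genus
    equation this bounds everything, and labelled graphs of a fixed type occur
    for finitely many sizes only. *)
Lemma of_type_bound g n G : of_type g n G ->
  [/\ (#|V| <= 2 * g + n)%N, (#|H| <= 6 * g + 3 * n)%N
    & forall v, (vgenus G v <= 6 * g + 3 * n)%N].
Proof.
move=> /and4P[_ /leq_stable sG _ /eqP gG].
split; [lia|lia|] => v.
by have : (vgenus G v <= \sum_v vgenus G v)%N; [rewrite (bigD1 v) //= leq_addr|lia].
Qed.

Lemma of_type_stable g n G : of_type g n G -> (2 < 2 * g + n)%N.
Proof.
move=> /and4P[/connectedP[v _] /leq_stable sG _ /eqP gG].
have : (0 < #|V|)%N by apply/card_gt0P; exists v.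
by lia.
Qed.

Lemma card_edges G : #|edges G| = ((#|H| - #|external G|)./2)%N.
Proof. by rewrite (card_half_edges G) addKn mul2n doubleK. Qed.

Definition vertex_product G : Qt :=
  \prod_v vertex_weight (vgenus G v) (valence G v).

Definition weight G : Qtk := vertex_product G *: kappa ^+ #|edges G|.

End Basics.

(** * Invariance under isomorphism *)

Section Iso.
Variables (V1 H1 V2 H2 : finType) (G1 : graph V1 H1) (G2 : graph V2 H2).
Variables (f : V1 -> V2) (k : H1 -> H2).
Hypothesis iso : is_iso G1 G2 f k.

Lemma iso_valence v : valence G2 (f v) = valence G1 v.
Proof.
have [bf bk _ er _] := iso.
rewrite /valence -(card_imset _ (bij_inj bk)); apply: eq_card => h.
rewrite !inE; apply/eqP/imsetP.
  have [k' kK k'K] := bk; move=> hv; exists (k' h); rewrite ?k'K// inE.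
  by apply/eqP/(bij_inj bf); rewrite -er k'K.
by move=> [x]; rewrite inE => /eqP <- ->; rewrite er.
Qed.

Lemma iso_external h : (k h \in external G2) = (h \in external G1).
Proof. by have [_ bk _ _ ef] := iso; rewrite !inE ef (inj_eq (bij_inj bk)). Qed.

Lemma iso_card_external : #|external G2| = #|external G1|.
Proof.
have [_ bk _ _ _] := iso; have [k' kK k'K] := bk.
rewrite -(card_imset _ (bij_inj bk)); apply: eq_card => h.
apply/idP/imsetP => [hE|[x xE ->]]; last by rewrite iso_external.
by exists (k' h); rewrite ?k'K// -iso_external k'K.
Qed.

Lemma iso_connected_imply : connected G1 -> connected G2.
Proof.
have [bf _ _ er ef] := iso; have [f' fK f'K] := bf.
move=> /connectedP[v cv]; apply/connectedP; exists (f v) => w.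
rewrite -(f'K w); apply: (connect_homo _ (cv _)) => x y.
move=> /existsP[h /andP[/eqP <- /eqP <-]]; apply: connect1.
by rewrite -!er -ef adj_root.
Qed.

Lemma iso_stable : stable G2 = stable G1.
Proof.
have [bf _ eg _ _] := iso; have [f' fK f'K] := bf.
apply/forallP/forallP => s v; first by rewrite -eg -iso_valence.
by rewrite -(f'K v) eg iso_valence.
Qed.

Lemma iso_sum_vgenus : (\sum_v vgenus G2 v = \sum_v vgenus G1 v)%N.
Proof.
have [bf _ eg _ _] := iso.
by rewrite (reindex f) /=; [apply: eq_bigr => v _|exact: onW_bij].
Qed.

Lemma iso_vertex_product : vertex_product G2 = vertex_product G1.
Proof.
have [bf _ eg _ _] := iso.
rewrite /vertex_product (reindex f) /=; last exact: onW_bij.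
by apply: eq_bigr => v _; rewrite eg iso_valence.
Qed.

Lemma iso_weight : weight G2 = weight G1.
Proof.
have [_ bk _ _ _] := iso.
by rewrite /weight iso_vertex_product !card_edges iso_card_external (bij_eq_card bk).
Qed.
End Iso.

Lemma is_iso_inv (V1 H1 V2 H2 : finType) (G1 : graph V1 H1) (G2 : graph V2 H2)
    f k f' k' : is_iso G1 G2 f k -> cancel f f' -> cancel k k' ->
  is_iso G2 G1 f' k'.
Proof.
move=> [bf bk eg er ef] fK kK.
have f'K : cancel f' f by exact/(bij_can_sym bf).
have k'K : cancel k' k by exact/(bij_can_sym bk).
split; [by exists f|by exists k| | | ].
- by move=> v; rewrite -{2}[v]f'K eg.
- by move=> h; rewrite -{2}[h]k'K er fK.
- by move=> h; rewrite -{2}[h]k'K ef kK.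
Qed.

Lemma iso_connected (V1 H1 V2 H2 : finType) (G1 : graph V1 H1)
    (G2 : graph V2 H2) f k :
  is_iso G1 G2 f k -> connected G2 = connected G1.
Proof.
move=> iso; apply/idP/idP; last exact: iso_connected_imply iso.
have [[f' fK _] [k' kK _] _ _ _] := iso.
exact: iso_connected_imply (is_iso_inv iso fK kK).
Qed.

Lemma iso_of_type (V1 H1 V2 H2 : finType) (G1 : graph V1 H1)
    (G2 : graph V2 H2) f k g n :
  is_iso G1 G2 f k -> of_type g n G2 = of_type g n G1.
Proof.
move=> iso; have [bf bk _ _ _] := iso.
rewrite /of_type (iso_connected iso) (iso_stable iso) (iso_card_external iso).
by rewrite (iso_sum_vgenus iso) (bij_eq_card bf) (bij_eq_card bk).
Qed.

(** * Labelled graphs and orbit counting *)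

Lemma natQt_eq0 (n : nat) : ((n%:R : Qt) == 0) = (n == 0%N).
Proof.
rewrite -(rmorph_nat (@FracField.tofrac {poly rat})) tofrac_eq0.
by rewrite -polyC_natr polyC_eq0 Num.Theory.pnatr_eq0.
Qed.

Lemma eq_card_bijection (T U : finType) :
  #|T| = #|U| -> exists f : T -> U, bijective f.
Proof.
move=> e; exists (fun x => enum_val (cast_ord e (enum_rank x))).
exists (fun y => enum_val (cast_ord (esym e) (enum_rank y))) => x.
  by rewrite enum_valK cast_ordK enum_rankK.
by rewrite enum_valK cast_ordKV enum_rankK.
Qed.

(** The symmetric group is k-transitive for every k. *)
Lemma perm_extend (T : finType) (s1 s2 : seq T) :
  uniq s1 -> uniq s2 -> size s1 = size s2 ->
  exists p : {perm T}, map p s1 = s2.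
Proof.
elim: s1 s2 => [|x1 s1 IHs] [|x2 s2] //=; first by exists 1%g.
move=> /andP[x1s u1] /andP[x2s u2] [/(IHs _ u1 u2)[p ps]].
exists (p * tperm (p x1) x2)%g; rewrite permM tpermL; congr cons.
rewrite -[RHS]ps; apply/eq_in_map => y ys; rewrite permM tpermD //.
  by rewrite (inj_eq perm_inj); apply: contraNneq x1s => ->.
by apply: contraNneq x2s => ->; rewrite -ps map_f.
Qed.

(** Used to move marked labels to standard positions. *)
Lemma bij_extend (T U : finType) (s : seq T) (r : seq U) :
  #|T| = #|U| -> uniq s -> uniq r -> size s = size r ->
  exists2 f : T -> U, bijective f & map f s = r.
Proof.
move=> /eq_card_bijection[f bf] us ur e.
have us' : uniq (map f s) by rewrite map_inj_uniq //; exact: bij_inj.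
have [|p ps] := perm_extend us' ur; first by rewrite size_map.
exists (p \o f); first by apply: bij_comp => //; exists p^-1%g; [exact: permK|exact: permKV].
by rewrite map_comp.
Qed.

Section Relabel.
Variables (V H V' H' : finType).
Variables (f : V -> V') (f' : V' -> V) (k : H -> H') (k' : H' -> H).
Hypotheses (fK : cancel f f') (f'K : cancel f' f).
Hypotheses (kK : cancel k k') (k'K : cancel k' k).
Variable G : graph V H.

Fact relabel_flipK : involutive (k \o flip G \o k').
Proof. by move=> h /=; rewrite kK flipK k'K. Qed.

Definition relabel : graph V' H' :=
  Graph (vgenus G \o f') (f \o root G \o k') relabel_flipK.

Lemma relabel_iso : is_iso G relabel f k.
Proof.
by split=> [| |v|h|h] /=; rewrite ?fK ?kK //; [exists f'|exists k'].
Qed.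
End Relabel.

Section Labelled.
Variable N : nat.

Definition involutions (H : finType) :=
  {s : {ffun H -> H} | [forall h, s (s h) == h]}.

Fact involutionsP (H : finType) (s : involutions H) : involutive (val s).
Proof. by move=> h; apply/eqP; have /forallP := valP s; apply. Qed.

(** A finite type of graphs on given sets of labels. The type of the genus
    function forces a bound N, chosen larger than any genus that can occur. *)
Definition lgraph (V H : finType) : finType :=
  ({ffun V -> 'I_N.+1} * {ffun H -> V} * involutions H)%type.

Definition graph_of (V H : finType) (y : lgraph V H) : graph V H :=
  Graph (fun v => val (y.1.1 v)) y.1.2 (involutionsP y.2).

Section Lab.
Variables V H : finType.
Implicit Types (G : graph V H) (y : lgraph V H).

Fact lgraph_of_subproof G : [forall h, finfun (flip G) (finfun (flip G) h) == h].
Proof. by apply/forallP => h; rewrite !ffunE flipK. Qed.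

Definition lgraph_of G : lgraph V H :=
  ([ffun v => inord (vgenus G v)], [ffun h => root G h],
   exist _ (finfun (flip G)) (lgraph_of_subproof G)).

Lemma lgraph_ofK G : (forall v, (vgenus G v <= N)%N) -> graph_of (lgraph_of G) = G.
Proof.
move=> gN; apply: graph_eq => [v|h|h] /=; rewrite ffunE //.
by rewrite inordK // ltnS.
Qed.

Lemma graph_of_bound y v : (vgenus (graph_of y) v <= N)%N.
Proof. by rewrite -ltnS /=. Qed.

Lemma graph_of_inj : injective (@graph_of V H).
Proof.
move=> [[a r] s] [[a' r'] s'] e; congr (_, _, _).
- by apply/ffunP => v; apply/val_inj; apply: (congr1 (@vgenus _ _ ^~ v) e).
- by apply/ffunP => h; apply: (congr1 (@root _ _ ^~ h) e).
- by apply/val_inj/ffunP => h; apply: (congr1 (@flip _ _ ^~ h) e).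
Qed.
End Lab.

(** A sum over labelled graphs depends on the label sets only up to bijection,
    also in the presence of marked labels, provided f and k respect the
    marks. *)
Lemma sum_iso (R : nmodType) (V H V' H' : finType) (f : V -> V') (k : H -> H')
    (F : graph V H -> R) (F' : graph V' H' -> R) :
  bijective f -> bijective k ->
  (forall G G', is_iso G G' f k -> F G = F' G') ->
  \sum_(y : lgraph V H) F (graph_of y) = \sum_(y : lgraph V' H') F' (graph_of y).
Proof.
move=> [f' fK f'K] [k' kK k'K] FF'; apply/esym.
pose psi (y : lgraph V H) : lgraph V' H' := lgraph_of (relabel f f' kK k'K (graph_of y)).
have psiE y : graph_of (psi y) = relabel f f' kK k'K (graph_of y).
  by apply: lgraph_ofK => v; exact: graph_of_bound.
rewrite (@sum_bij _ _ _ predT predT _ psi) //=.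
- apply: eq_bigr => y _; rewrite psiE; apply/esym/FF'; exact: relabel_iso.
- move=> y y' _ _ /(congr1 (@graph_of _ _)); rewrite !psiE => e.
  apply: graph_of_inj; apply: graph_eq => [v|h|h].
  + by have := congr1 (@vgenus _ _ ^~ (f v)) e; rewrite /= fK.
  + by have := congr1 (@root _ _ ^~ (k h)) e; rewrite /= kK => /(can_inj fK).
  + by have := congr1 (@flip _ _ ^~ (k h)) e; rewrite /= kK => /(can_inj kK).
- move=> y _; pose G := relabel f' f k'K kK (graph_of y).
  exists (lgraph_of G) => //; apply: graph_of_inj; rewrite psiE lgraph_ofK;
    last by move=> v; exact: graph_of_bound.
  by apply: graph_eq => [v|h|h] /=; rewrite ?f'K ?k'K.
Qed.

Definition total (g n : nat) (V H : finType) : Qtk :=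
  \sum_(y : lgraph V H | of_type g n (graph_of y)) weight (graph_of y).

Lemma card_perms (T : finType) : #|{: {perm T}}| = (#|T|)`!%N.
Proof.
rewrite -cardsT -(card_perm [set: T]%SET); apply: eq_card => p.
by rewrite !inE; apply/esym/fintype.subsetP.
Qed.

(** Orbit-stabilizer for relabelling: each way of turning G into a given y is
    obtained from one of them by composition with an automorphism of G. *)
Lemma card_relabellings (V H : finType) (G : graph V H) :
  (forall v, (vgenus G v <= N)%N) ->
  (#|[set y : lgraph V H | `[< isomorphic (graph_of y) G >]]%SET| * #|Aut G| =
   (#|V|)`! * (#|H|)`!)%N.
Proof.
move=> gN.
pose isos (y : lgraph V H) : {set {perm V} * {perm H}} :=
  [set p : {perm V} * {perm H} | `[< is_iso G (graph_of y) p.1 p.2 >]]%SET.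
pose act (p : {perm V} * {perm H}) : lgraph V H :=
  lgraph_of (relabel p.1 (p.1^-1)%g (permK p.2) (permKV p.2) G).
have actE p : graph_of (act p) =
    relabel p.1 (p.1^-1)%g (permK p.2) (permKV p.2) G.
  by apply: lgraph_ofK => v; exact: gN.
have isosE y p : (p \in isos y) = (act p == y).
  rewrite inE; apply/asboolP/eqP => [iso|<-]; last first.
    rewrite actE; apply: relabel_iso; [exact: permK|exact: permKV].
  apply: graph_of_inj; rewrite actE; case: iso => _ _ eg er ef.
  apply: graph_eq => [v|h|h].
  - by rewrite -[in RHS](permKV p.1 v) eg.
  - by rewrite -[in RHS](permKV p.2 h) er.
  - by rewrite -[in RHS](permKV p.2 h) ef.
rewrite -!card_perms -card_prod -sum1_card -(sum1_card {: {perm V} * {perm H}}).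
rewrite (partition_big act predT) //= big_distrl /=.
rewrite (big_mkcond (fun y => y \in _)) /=; apply: eq_bigr => y _.
rewrite inE mul1n; have -> : (\sum_(p | act p == y) 1 = #|isos y|)%N.
  by rewrite -sum1_card; apply: eq_bigl => p; rewrite isosE.
case: asboolP => [/isomorphic_sym[f [k iso]]|niso]; last first.
  apply/esym/eqP; rewrite cards_eq0; apply/eqP/setP => p; rewrite !inE.
  apply/negbTE/asboolP => iso; apply: niso; apply: isomorphic_sym.
  by exists p.1, p.2.
have [bf bk _ _ _] := iso.
pose pf := perm (bij_inj bf); pose pk := perm (bij_inj bk).
have pfE : pf = f :> (V -> V) by apply/funext => v; rewrite permE.
have pkE : pk = k :> (H -> H) by apply/funext => v; rewrite permE.
have {}iso : is_iso G (graph_of y) pf pk by rewrite pfE pkE.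
(* The isomorphisms from G to y form the coset of Aut G through (pf, pk). *)
have mI : injective (fun a : {perm V} * {perm H} => (a.1 * pf, a.2 * pk)%g).
  by move=> [a b] [a' b'] [/mulIg-> /mulIg->].
rewrite -(card_imset _ mI); apply: eq_card => -[p q]; apply/imsetP/idP.
  move=> [[a b]]; rewrite inE => /asboolP aA ->; rewrite inE; apply/asboolP.
  change (is_iso G (graph_of y) (a * pf)%g (b * pk)%g).
  case: aA iso => _ _ eg er ef [_ _ eg' er' ef'].
  split=> [| |v|h|h].
  - by exists (a * pf)^-1%g; [exact: permK|exact: permKV].
  - by exists (b * pk)^-1%g; [exact: permK|exact: permKV].
  - by rewrite permM eg' eg.
  - by rewrite !permM er' er.
  - by rewrite !permM ef' ef.
rewrite inE => /asboolP piso.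
exists (p * pf^-1, q * pk^-1)%g; last by rewrite /= !mulgKV.
rewrite inE; apply/asboolP.
change (is_iso G G (p * pf^-1)%g (q * pk^-1)%g).
case: piso iso => _ _ eg er ef [_ _ eg' er' ef'].
split=> [| |v|h|h].
- by exists (p * pf^-1)^-1%g; [exact: permK|exact: permKV].
- by exists (q * pk^-1)^-1%g; [exact: permK|exact: permKV].
- by rewrite permM -eg' permKV eg.
- by rewrite !permM; apply: (@perm_inj _ pf); rewrite -er' !permKV er.
- by rewrite !permM; apply: (@perm_inj _ pk); rewrite -ef' !permKV ef.
Qed.

Definition class_of (v h : nat) (y : lgraph 'I_v 'I_h) : graph_class :=
  \pi_graph_class%qT (OrdGraph (graph_of y)).

Lemma class_ofE v h (y : lgraph 'I_v 'I_h) (x : graph_class) :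
  (class_of y == x) = `[< isomorphic (graph_of y) (repr x : ord_graph) >].
Proof.
apply/eqP/asboolP => [e|iso].
  have /eqmodP/asboolP // :
    (OrdGraph (graph_of y) = repr x %[mod graph_class])%qT.
  by rewrite reprK.
by rewrite -[x]reprK; apply/eqmodP/asboolP.
Qed.

Lemma aut_neq0 (V H : finType) (G : graph V H) : #|Aut G| != 0%N.
Proof.
rewrite cards_eq0; apply/set0Pn; exists 1%g; rewrite inE; apply/asboolP.
by split=> [| |v|h|h] /=; rewrite ?perm1 //; exists id => x; rewrite perm1.
Qed.

(** Passage from isomorphism classes to labelled graphs. Any bounds on the
    sizes that are large enough will do, as the labelled graphs beyond them
    contribute nothing; this freedom absorbs the index shifts caused by adding vertices and
    half-edges. *)
Lemma chi_total g n Mv Mh : (6 * g + 3 * n <= N)%N ->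
  (2 * g + n < Mv)%N -> (6 * g + 3 * n < Mh)%N ->
  chi g n = \sum_(v < Mv) \sum_(h < Mh)
              ((v`! * h`!)%N%:R)^-1 *: total g n 'I_v 'I_h.
Proof.
move=> gN gMv gMh; have finS := finite_stable_classes g n.
rewrite /chi fsbig_finite //=; set S := fset_set _.
have SP x : x \in S -> of_type g n (repr x : ord_graph).
  rewrite in_fset_set // inE => -[G [xE cG sG gG nG]].
  have : isob (repr x) G by apply/eqmodP; rewrite reprK xE.
  move=> /asboolP/isomorphic_sym[f [k iso]].
  by rewrite (iso_of_type g n iso); apply/of_typeP.
have totalE v h : total g n 'I_v 'I_h = \sum_(x <- S)
    #|[set y : lgraph 'I_v 'I_h | class_of y == x]%SET|%:R
      *: weight (repr x : ord_graph).
  transitivity (\sum_(y : lgraph 'I_v 'I_h | of_type g n (graph_of y))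
      \sum_(x <- S | class_of y == x) weight (repr x : ord_graph)).
    apply: eq_bigr => y yP.
    have yS : class_of y \in S.
      rewrite in_fset_set // inE; have [cG sG gG nG] := of_typeP _ _ _ yP.
      by exists (OrdGraph (graph_of y)).
    rewrite (big_rem (class_of y)) //= eqxx big_seq_cond big1 ?addr0; last first.
      move=> x /andP[]; rewrite rem_filter ?fset_uniq // mem_filter /=.
      by move=> /andP[/negbTE nx _] /eqP xE; rewrite xE eqxx in nx.
    have : isomorphic (graph_of y) (repr (class_of y) : ord_graph).
      by apply/asboolP; rewrite -class_ofE.
    by move=> [f [k iso]]; rewrite (iso_weight iso).
  rewrite (exchange_big_dep xpredT) //= [LHS]big_seq [RHS]big_seq.
  apply: eq_bigr => x /SP xP; rewrite scaler_nat -sumr_const.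
  rewrite [RHS](eq_bigl (fun y => class_of y == x)); last by move=> y; rewrite !inE.
  apply: eq_bigl => y; rewrite andbC andb_idr // class_ofE => /asboolP.
  by move=> /isomorphic_sym[f [k iso]]; rewrite (iso_of_type g n iso).
under [RHS]eq_bigr do under eq_bigr do rewrite totalE scaler_sumr.
under [RHS]eq_bigr do rewrite exchange_big.
rewrite /= [RHS]exchange_big [LHS]big_seq [RHS]big_seq /=.
apply: eq_bigr => x /SP xP; set G := repr x : ord_graph.
have [] := of_type_bound xP; rewrite !card_ord => bV bH bg.
have vG : (nv G < Mv)%N by rewrite (leq_ltn_trans bV).
have hG : (nh G < Mh)%N by rewrite (leq_ltn_trans bH).
have zero v h : (v, h) != (nv G, nh G) ->
    #|[set y : lgraph 'I_v 'I_h | class_of y == x]%SET| = 0%N.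
  move=> ne; apply/eqP; rewrite cards_eq0; apply: contraNT ne => /set0Pn[y].
  rewrite inE class_ofE => /asboolP[f [k [bf bk _ _ _]]].
  have := bij_eq_card bf; have := bij_eq_card bk.
  by rewrite !card_ord => -> ->.
rewrite (bigD1 (Ordinal vG)) //= [X in _ + X]big1 ?addr0; last first.
  move=> v nv; rewrite big1 // => h _; rewrite zero ?scale0r ?scaler0 //.
  by apply: contra nv => /eqP[e _]; apply/eqP/val_inj.
rewrite (bigD1 (Ordinal hG)) //= [X in _ + X]big1 ?addr0; last first.
  move=> h nh; rewrite zero ?scale0r ?scaler0 //.
  by apply: contra nh => /eqP[e]; apply/eqP/val_inj.
have -> : graph_weight G = #|Aut G|%:R^-1 *: weight G by rewrite /weight scalerA.
rewrite [RHS]scalerA; congr (_ *: _).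
have /card_relabellings := fun v => leq_trans (bg v) gN.
rewrite !card_ord => E.
have cE : #|[set y : lgraph 'I_(nv G) 'I_(nh G) | class_of y == x]%SET| =
    #|[set y : lgraph 'I_(nv G) 'I_(nh G) | `[< isomorphic (graph_of y) G >]]%SET|.
  by apply: eq_card => y; rewrite !inE class_ofE.
have fact0 : (((nv G)`! * (nh G)`!)%N%:R : Qt) != 0.
  by rewrite natQt_eq0 -lt0n muln_gt0 !fact_gt0.
have aut0 : ((#|Aut G|)%:R : Qt) != 0 by rewrite natQt_eq0 aut_neq0.
rewrite cE; apply: (mulfI fact0); rewrite mulrA mulfV // mul1r -E natrM mulfK //.
Qed.
End Labelled.

(** * Differentiation in t *)

(** The embedding of polynomials with its codomain stated as [Qt], so that all
    ring operations below refer to one field structure. *)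
Definition toQt (p : {poly rat}) : Qt := FracField.tofrac p.

Lemma toQtM p q : toQt (p * q) = toQt p * toQt q.
Proof. exact: tofracM. Qed.

Lemma toQtD p q : toQt (p + q) = toQt p + toQt q.
Proof. exact: tofracD. Qed.

Lemma toQtB p q : toQt (p - q) = toQt p - toQt q.
Proof. exact: tofracB. Qed.

Lemma toQtX p n : toQt (p ^+ n) = toQt p ^+ n.
Proof. exact: tofracXn. Qed.

Lemma toQt1 : toQt 1 = 1.
Proof. exact: tofrac1. Qed.

Lemma toQt_eq0 p : (toQt p == 0) = (p == 0).
Proof. exact: tofrac_eq0. Qed.

Lemma toQt_surj (x : Qt) :
  exists p q : {poly rat}, q != 0 /\ x = toQt p / toQt q.
Proof.
pose p := \n_(repr x); pose q := \d_(repr x).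
have q0 : q != 0 by exact: denom_ratioP.
exists p, q; split=> //; apply: (canRL (mulfK _)); first by rewrite toQt_eq0.
rewrite -[x in LHS]reprK -[LHS]/(FracField.mul _ _) /toQt !piE /FracField.mulf.
apply/eqmodP; rewrite /= FracField.equivfE.
by rewrite !numden_Ratio ?mulf_neq0 ?oner_eq0// !mulr1 mulrC.
Qed.

Lemma dfrac_toQt p q : q != 0 -> dfrac (toQt p / toQt q) =
  (toQt p^`() * toQt q - toQt p * toQt q^`()) / toQt q ^+ 2.
Proof. by move=> q0; rewrite -!toQtM -toQtB -toQtX; exact: dfrac_div. Qed.

Lemma quotient_ruleM (F : fieldType) (a b c d a' b' c' d' : F) :
  b != 0 -> d != 0 ->
  ((a' * c + a * c') * (b * d) - a * c * (b' * d + b * d')) / (b * d) ^+ 2 =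
  (a' * b - a * b') / b ^+ 2 * (c / d) + a / b * ((c' * d - c * d') / d ^+ 2).
Proof. by move=> b0 d0; field; rewrite d0 b0. Qed.

Lemma quotient_ruleB (F : fieldType) (a b c d a' b' c' d' : F) :
  b != 0 -> d != 0 ->
  ((a' * d + a * d' - (c' * b + c * b')) * (b * d)
    - (a * d - c * b) * (b' * d + b * d')) / (b * d) ^+ 2 =
  (a' * b - a * b') / b ^+ 2 - (c' * d - c * d') / d ^+ 2.
Proof. by move=> b0 d0; field; rewrite d0 b0. Qed.

Lemma dfracM (x y : Qt) : dfrac (x * y) = dfrac x * y + x * dfrac y.
Proof.
have [p [q [q0 ->]]] := toQt_surj x; have [r [s [s0 ->]]] := toQt_surj y.
rewrite mulf_div -!toQtM !dfrac_toQt ?mulf_neq0 // !derivM !(toQtM, toQtD).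
by apply: quotient_ruleM; rewrite toQt_eq0.
Qed.

Fact dfrac_zmod_morphism : zmod_morphism dfrac.
Proof.
move=> x y.
have [p [q [q0 ->]]] := toQt_surj x; have [r [s [s0 ->]]] := toQt_surj y.
have -> : toQt p / toQt q - toQt r / toQt s = toQt (p * s - r * q) / toQt (q * s).
  by rewrite toQtB !toQtM -mulNr addf_div ?toQt_eq0 // mulNr.
rewrite !dfrac_toQt ?mulf_neq0 // derivB !derivM !(toQtB, toQtM, toQtD).
by apply: quotient_ruleB; rewrite toQt_eq0.
Qed.

HB.instance Definition _ :=
  GRing.isZmodMorphism.Build Qt Qt dfrac dfrac_zmod_morphism.

Lemma dfrac1 : dfrac 1 = 0.
Proof. by apply: (addrI (dfrac 1)); rewrite addr0 -{3}[1]mulr1 dfracM mulr1 mul1r. Qed.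

Lemma dfrac_natMV (n : nat) (x : Qt) : dfrac (n%:R^-1 * x) = n%:R^-1 * dfrac x.
Proof.
have [->|n0] := eqVneq n 0%N; first by rewrite invr0 !mul0r raddf0.
have n0' : (n%:R : Qt) != 0 by rewrite natQt_eq0.
by apply: (mulfI n0'); rewrite mulVKf // mulr_natl -raddfMn -[(_ * x) *+ n]mulr_natl mulVKf.
Qed.

Lemma toQt_int (z : int) : toQt (z%:~R)%:P = z%:~R.
Proof. by rewrite rmorph_int; exact: (rmorph_int (@FracField.tofrac {poly rat})). Qed.

(** Makes [ratr] multiplicative into [Qt], which carries no order. *)
Lemma ratr_toQt (r : rat) : ratr r = toQt r%:P.
Proof.
have d0 : ((denq r)%:~R : Qt) != 0.
  by rewrite -toQt_int toQt_eq0 polyC_eq0 intr_eq0 denq_eq0.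
rewrite /ratr; apply: (mulIf d0); rewrite mulfVK // -!toQt_int -toQtM -polyCM.
by rewrite -{2}[r]divq_num_den mulfVK // intr_eq0 denq_eq0.
Qed.

Lemma dfrac_ratr (r : rat) : dfrac (ratr r) = 0.
Proof.
rewrite ratr_toQt -[toQt _]divr1 -toQt1 dfrac_toQt ?oner_eq0 // !derivC.
by rewrite -!toQtM -toQtB mul0r mulr0 subr0 -[toQt 0]/(FracField.tofrac 0) tofrac0 mul0r.
Qed.

Lemma dfrac_prod (I : finType) (F : I -> Qt) :
  dfrac (\prod_i F i) = \sum_i \prod_j (if j == i then dfrac (F j) else F j).
Proof.
rewrite -[index_enum I]enumT; move: (enum_uniq I); elim: (enum I) => [|x s IHs].
  by rewrite !big_nil dfrac1.
rewrite cons_uniq => /andP[xs us]; rewrite !big_cons dfracM (IHs us) eqxx.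
congr (_ * _ + _).
  by apply: eq_big_seq => j js; case: eqVneq js xs => // -> ->.
rewrite big_distrr; apply: eq_big_seq => i i_s; rewrite big_cons.
by case: eqVneq i_s xs => // <- ->.
Qed.

Lemma tvarE : tvar = toQt 'X.
Proof. by []. Qed.

Lemma dfrac_tvar : dfrac tvar = 1.
Proof.
rewrite tvarE -[toQt 'X]divr1 -toQt1 dfrac_toQt ?oner_eq0 // derivX derivC.
by rewrite -!toQtM -toQtB mulr0 subr0 mulr1 -toQtX expr1n divff // toQt_eq0 oner_eq0.
Qed.

Lemma tvar_neq0 : tvar != 0.
Proof. by rewrite tvarE toQt_eq0 polyX_eq0. Qed.

Lemma power_ruleS (F : fieldType) (t x c : F) : t != 0 ->
  1 * x + t * (c * x / t) = (c + 1) * (t * x) / t.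
Proof. by move=> t0; field. Qed.

Lemma power_ruleV (F : fieldType) (t x c : F) : t != 0 -> x != 0 ->
  0 = c * x / t * x^-1 + x * (- c * x^-1 / t).
Proof. by move=> t0 x0; field; rewrite t0. Qed.

Lemma dfrac_tvarX (n : nat) : dfrac (tvar ^+ n) = n%:R * tvar ^+ n / tvar.
Proof.
elim: n => [|n IHn]; first by rewrite dfrac1 !mul0r.
rewrite exprS dfracM dfrac_tvar IHn -natr1.
exact: power_ruleS tvar_neq0.
Qed.

Lemma dfrac_tvarXz (z : int) : dfrac (tvar ^ z) = z%:~R * tvar ^ z / tvar.
Proof.
have t0 := tvar_neq0.
case: z => n; first by rewrite -exprnP dfrac_tvarX -pmulrn.
rewrite NegzE -exprnN.
have tn0 : tvar ^+ n.+1 != 0 by rewrite expf_neq0.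
apply: (mulfI tn0); apply: (addrI (dfrac (tvar ^+ n.+1) / tvar ^+ n.+1)).
rewrite -dfracM mulfV // dfrac1 dfrac_tvarX mulrNz -pmulrn.
exact: power_ruleV.
Qed.

(** The Euler characteristic of the universal curve: M_(g,n+1) fibres over
    M_(g,n) with fibre a curve of Euler characteristic 2-2g-n. *)
Lemma chiM_S (g n : nat) : (2 < 2 * g + n)%N ->
  chiM g n.+1 = (2 - 2 * g%:Z - n%:Z)%:~R * chiM g n.
Proof.
move=> st; rewrite /chiM.
have -> : (2 * g + n.+1 - 3 = (2 * g + n - 3).+1)%N by lia.
have -> : 2 - 2 * g%:Z - n%:Z = - (2 * g + n - 3).+1%:Z by lia.
rewrite mulrNz -pmulrn.
rewrite factS natrM exprS; ring.
Qed.

(** The exponent of t is the Euler characteristic 2-2g-n, so differentiating in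
    t puts one more marked point on the vertex. *)
Lemma dfrac_vertex_weight (g n : nat) : (2 < 2 * g + n)%N ->
  dfrac (vertex_weight g n) = vertex_weight g n.+1.
Proof.
move=> st; rewrite /vertex_weight dfracM dfrac_ratr mul0r add0r dfrac_tvarXz.
have ratrZ z c : ratr (z%:~R * c) = z%:~R * ratr c :> Qt.
  by rewrite !ratr_toQt -toQt_int -toQtM -polyCM.
rewrite chiM_S // ratrZ.
have -> : 2 - 2 * g%:Z - n.+1%:Z = (2 - 2 * g%:Z - n%:Z) - 1 by lia.
rewrite [in RHS]expfzDr ?tvar_neq0 // exprN1.
by rewrite [LHS]mulrA [RHS]mulrA; congr (_ / _); rewrite mulrA [ratr _ * _]mulrC.
Qed.

Lemma d_tZX (c : Qt) (n : nat) : d_t (c *: kappa ^+ n) = dfrac c *: kappa ^+ n.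
Proof.
apply/polyP => i; rewrite coef_map_id0 ?raddf0 // !coefZ /kappa coefXn.
by case: (i == n); rewrite ?mulr1 ?mulr0 ?raddf0.
Qed.

Fact d_t_zmod_morphism : zmod_morphism d_t.
Proof.
move=> p q; apply/polyP => i; rewrite coefB !coef_map_id0 ?raddf0 //.
by rewrite coefB raddfB.
Qed.

HB.instance Definition _ :=
  GRing.isZmodMorphism.Build Qtk Qtk d_t d_t_zmod_morphism.

Lemma d_t_natVZ (n : nat) p : d_t (n%:R^-1 *: p) = n%:R^-1 *: d_t p.
Proof.
apply/polyP => i; rewrite coef_map_id0 ?raddf0 // !coefZ.
by rewrite coef_map_id0 ?raddf0 // dfrac_natMV.
Qed.

(** * Adding a leg at a vertex *)

Lemma big_option (R : Type) (idx : R) (op : Monoid.com_law idx) (T : finType)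
    (F : option T -> R) :
  \big[op/idx]_x F x = op (F None) (\big[op/idx]_x F (Some x)).
Proof.
rewrite (bigD1 None) //=; congr (op _ _).
rewrite (reindex_omap Some id) => [|[]] //.
by apply: eq_bigl => x; rewrite eqxx.
Qed.

Lemma valenceE (V H : finType) (G : graph V H) v :
  valence G v = (\sum_h (root G h == v))%N.
Proof.
rewrite /valence -sum1_card big_mkcond /=; apply: eq_bigr => h _.
by rewrite inE; case: eqP.
Qed.

Lemma card_externalE (V H : finType) (G : graph V H) :
  #|external G| = (\sum_h (flip G h == h))%N.
Proof.
rewrite -sum1_card big_mkcond /=; apply: eq_bigr => h _.
by rewrite inE; case: eqP.
Qed.

Lemma connected_map (V H V' H' : finType) (G : graph V H) (G' : graph V' H')
    (f : V -> V') :
  (forall h, connect (adj G') (f (root G h)) (f (root G (flip G h)))) ->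
  (forall w, exists v, connect (adj G') w (f v)) ->
  connected G -> connected G'.
Proof.
move=> fG fV /connectedP[v cv]; apply/connectedP; exists (f v) => w.
have [u wu] := fV w; rewrite connect_adj_sym in wu.
apply: connect_trans wu; apply: (connect_homo _ (cv u)) => x y.
by move=> /existsP[h /andP[/eqP <- /eqP <-]].
Qed.

Section AddLeg.
Variables (V H : finType) (G : graph V H) (v : V).

Fact add_leg_flipK : involutive (omap (flip G)).
Proof. by case=> //= h; rewrite flipK. Qed.

Definition add_leg : graph V (option H) :=
  Graph (vgenus G) (oapp (root G) v) add_leg_flipK.

Lemma add_leg_valence w : valence add_leg w = ((v == w) + valence G w)%N.
Proof. by rewrite !valenceE big_option. Qed.

Lemma add_leg_card_external : #|external add_leg| = #|external G|.+1.
Proof. by rewrite !card_externalE big_option. Qed.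

Lemma add_leg_connected : connected add_leg = connected G.
Proof.
apply/idP/idP; apply: (connected_map (f := id)).
- by case=> [h|] //=; apply/connect1/adj_root.
- by move=> w; exists w.
- by move=> h; apply/connect1; apply: (adj_root add_leg (Some h)).
- by move=> w; exists w.
Qed.

Lemma add_leg_of_type g n : stable G ->
  of_type g n.+1 add_leg = of_type g n G.
Proof.
move=> sG; have sG' : stable add_leg.
  apply/forallP => w; have /forallP/(_ w) := sG.
  by rewrite add_leg_valence /=; lia.
rewrite /of_type add_leg_connected sG sG' add_leg_card_external eqSS card_option.
by rewrite /= !addnS !addSn eqSS.
Qed.

(** The weight is the term of the Leibniz rule that differentiates the factor
    of v. *)
Lemma add_leg_weight : stable G -> weight add_leg =
  (\prod_w (if w == v then dfrac (vertex_weight (vgenus G w) (valence G w))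
            else vertex_weight (vgenus G w) (valence G w)))
    *: kappa ^+ #|edges G|.
Proof.
move=> /forallP sG; rewrite /weight !card_edges add_leg_card_external card_option.
rewrite subSS; congr (_ *: _); apply: eq_bigr => w _.
by rewrite add_leg_valence eq_sym; case: eqP => // _; rewrite dfrac_vertex_weight.
Qed.
End AddLeg.

Lemma d_t_weight (V H : finType) (G : graph V H) : stable G ->
  d_t (weight G) = \sum_v weight (add_leg G v).
Proof.
move=> sG; rewrite d_tZX dfrac_prod scaler_suml.
by apply: eq_bigr => v _; rewrite add_leg_weight.
Qed.

(** Stability of the root of l once l is erased. *)
Definition redundant_leg (V H : finType) (G : graph V H) (l : H) : bool :=
  (2 < 2 * vgenus G (root G l) + (valence G (root G l)).-1)%N.

Section AddLegSum.
Variables (N : nat).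

(** Erasing the leg None is inverse to [add_leg]. *)
Lemma sum_redundant_None g n (V H : finType) :
  \sum_(y : lgraph N V (option H) | [&& of_type g n.+1 (graph_of y),
       None \in external (graph_of y) & redundant_leg (graph_of y) None])
    weight (graph_of y) = d_t (total N g n V H).
Proof.
rewrite /total raddf_sum /=.
transitivity (\sum_(y : lgraph N V H | of_type g n (graph_of y))
   \sum_v weight (add_leg (graph_of y) v)); last first.
  by apply: eq_bigr => y /and4P[_ sG _ _]; rewrite d_t_weight.
rewrite pair_big /=.
pose psi (p : lgraph N V H * V) := lgraph_of N (add_leg (graph_of p.1) p.2).
have psiE p : graph_of (psi p) = add_leg (graph_of p.1) p.2.
  by apply: lgraph_ofK => v; exact: graph_of_bound.
rewrite (@sum_bij _ _ _ _ (fun p : lgraph N V H * V => of_type g n (graph_of p.1)) _ psi) //=.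
- by apply: eq_big => [p|p _]; rewrite ?andbT ?psiE.
- move=> [y v] [y' v'] _ _ /(congr1 (@graph_of _ _ _)); rewrite !psiE /= => e.
  congr (_, _); last exact: (congr1 (@root _ _ ^~ None) e).
  apply: graph_of_inj; apply: graph_eq => [w|h|h].
  + exact: (congr1 (@vgenus _ _ ^~ w) e).
  + exact: (congr1 (@root _ _ ^~ (Some h)) e).
  + by have [] := congr1 (@flip _ _ ^~ (Some h)) e.
- move=> [y v] /= yP; rewrite psiE /=; have /and4P[_ sG _ _] := yP.
  rewrite add_leg_of_type // yP inE eqxx /= /redundant_leg /= add_leg_valence eqxx.
  by have /forallP := sG; apply.
- move=> y /and3P[yP]; rewrite inE => /eqP fN rl.
  have GN := graph_of_bound y.
  move Gy : (graph_of y) yP fN rl GN => G yP fN rl GN.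
  have flipS h : exists h', flip G (Some h) = Some h'.
    case E : (flip G (Some h)) => [h'|]; first by exists h'.
    by have := flipK G (Some h); rewrite E fN.
  have [s sE] := fin_all_exists flipS.
  have sK : involutive s.
    by move=> h; have := flipK G (Some h); rewrite !sE => -[].
  pose G' := Graph (vgenus G) (root G \o Some) sK.
  have GE : G = add_leg G' (root G None).
    by apply: graph_eq => [v|[h|]|[h|]] //=; rewrite ?sE ?fN.
  have sG' : stable G'.
    apply/forallP => w; have /and4P[_ /forallP/(_ w) sG _ _] := yP.
    move: rl sG; rewrite /redundant_leg GE /= !add_leg_valence eqxx.
    by case: eqVneq => [->|_] //=; rewrite !add0n.
  exists (lgraph_of N G', root G None) => /=.
    rewrite lgraph_ofK; last by move=> v; exact: GN.
    by rewrite -(add_leg_of_type (root G None)) // -GE.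
  apply: graph_of_inj; rewrite psiE /= lgraph_ofK -?GE ?Gy // => v; exact: GN.
Qed.

Lemma iso_redundant_leg (V H V' H' : finType) (G : graph V H) (G' : graph V' H')
  f k : is_iso G G' f k ->
  forall l, redundant_leg G' (k l) = redundant_leg G l.
Proof.
move=> iso l; have [_ _ eg er _] := iso.
by rewrite /redundant_leg er eg (iso_valence iso).
Qed.

Lemma sum_redundant g n (V : finType) h :
  \sum_(l < h.+1) \sum_(y : lgraph N V 'I_h.+1 | [&& of_type g n.+1 (graph_of y),
       l \in external (graph_of y) & redundant_leg (graph_of y) l])
    weight (graph_of y) = d_t (total N g n V 'I_h) *+ h.+1.
Proof.
rewrite -[h.+1 in RHS]card_ord -sumr_const; apply: eq_bigr => l _.
rewrite -sum_redundant_None.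
have [|k bk [kl]] := @bij_extend (option 'I_h) 'I_h.+1 [:: None] [:: l] _ isT isT erefl.
  by rewrite card_option !card_ord.
pose F (H : finType) (l : H) (G : graph V H) : Qtk := if [&& of_type g n.+1 G,
       l \in external G & redundant_leg G l] then weight G else 0.
rewrite [LHS]big_mkcond [RHS]big_mkcond /=; apply/esym.
apply: (@sum_iso N _ _ _ _ _ id k (F _ None) (F _ l)) => //; first by exists id.
move=> G G' iso; rewrite /F -kl (iso_of_type g n.+1 iso) (iso_external iso).
by rewrite (iso_redundant_leg iso) (iso_weight iso).
Qed.
End AddLegSum.

Definition add3 (H : finType) : finType := option (option (option H)).
Definition new_leg (H : finType) : add3 H := None.
Definition armA (H : finType) : add3 H := Some None.
Definition armB (H : finType) : add3 H := Some (Some None).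
Definition old_half (H : finType) (h : H) : add3 H := Some (Some (Some h)).

(** * Inserting a trivalent vertex *)

Lemma vertex_weight03 : vertex_weight 0 3 = tvar^-1.
Proof.
have B0 : bernoulli 0 = 1 by have := bernoulli_rec 0; rewrite big_ord1 bin0 mul1r.
have -> : vertex_weight 0 3 = ratr (chiM 0 3) * tvar ^ (-1) by [].
rewrite /chiM muln0 B0 -[(0 + 3 - 3)%N]/0%N fact0 mulr1 mulr1 divr1 sub0r.
by rewrite -exprSr -signr_odd expr0 ratr_toQt toQt1 mul1r exprN1.
Qed.

Section InsertVertex.
Variables (V H : finType) (G : graph V H) (c : H).

Definition insert_root (x : add3 H) : option V :=
  if x is Some (Some (Some h)) then Some (root G h) else None.

(** The edge of c is broken and its two ends are joined to the arms of the new
    vertex. The definition also covers an external c: there is then no second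
    end, and arm B becomes the external edge in its place. *)
Definition insert_flip (x : add3 H) : add3 H :=
  match x with
  | None => new_leg H
  | Some None => old_half c
  | Some (Some None) => if flip G c == c then armB H else old_half (flip G c)
  | Some (Some (Some h)) =>
      if h == c then armA H else
      if h == flip G c then armB H else old_half (flip G h)
  end.

Fact insert_flipK : involutive insert_flip.
Proof.
have fI := can_inj (flipK G).
move=> [[[h|]|]|] //=; last by rewrite eqxx.
  case: eqVneq => [->|hc] //=.
  case: eqVneq => [hfc|hfc] /=.
    by move: hc; rewrite hfc => /negbTE ->.
  rewrite (inv_eq (flipK G)) (negbTE hfc) (inj_eq fI) (negbTE hc).
  by rewrite flipK.
case: (eqVneq (flip G c) c) => [e|fc] /=; first by rewrite e eqxx.
by rewrite (negbTE fc) eqxx.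
Qed.

Definition insert_vertex : graph (option V) (add3 H) :=
  Graph (oapp (vgenus G) 0%N) insert_root insert_flipK.

Lemma insert_vertex_valence v :
  valence insert_vertex v = oapp (valence G) 3 v.
Proof.
rewrite valenceE !big_option /=.
case: v => [v|] /=; last by rewrite big1.
by rewrite !add0n valenceE.
Qed.

Lemma insert_vertex_external_old h :
  (old_half h \in external insert_vertex) = (h != c) && (h \in external G).
Proof.
rewrite !inE /= /old_half; case: (eqVneq h c) => [->//|hc] /=.
case: (eqVneq h (flip G c)) => [e|hfc]; last first.
  by apply/eqP/eqP => [[]//|->].
by rewrite e flipK; apply/esym/negbTE; apply: contraNneq hc => ec; rewrite e -ec.
Qed.

Lemma insert_vertex_armB :
  (armB H \in external insert_vertex) = (c \in external G).
Proof. by rewrite !inE /=; case: (eqVneq (flip G c) c). Qed.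

Lemma insert_vertex_card_external : #|external insert_vertex| = #|external G|.+1.
Proof.
have E (A : {set add3 H}) : #|A| =
    ((new_leg H \in A) + ((armA H \in A) + ((armB H \in A)
      + \sum_h (old_half h \in A))))%N.
  rewrite -sum1_card big_mkcond (eq_bigr (fun x => nat_of_bool (x \in A))).
    by rewrite !big_option.
  by move=> x _; case: (x \in A).
have -> : #|external G| = ((c \in external G) + \sum_h ((h != c) && (h \in external G)))%N.
  rewrite -sum1_card big_mkcond /= (bigD1 c) //= [in RHS](bigD1 c) //= eqxx /= add0n.
  congr (_ + _)%N.
  by apply: eq_bigr => h ->; case: ifP.
rewrite E insert_vertex_armB !inE /=.
by under eq_bigr do rewrite insert_vertex_external_old.
Qed.

Lemma insert_vertex_connected : connected insert_vertex = connected G.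
Proof.
apply/idP/idP.
  apply: (connected_map (f := oapp id (root G c))); last by move=> w; exists (Some w).
  case=> [[[h|]|]|] //=; first last.
    by case: (eqVneq (flip G c) c) => //= _; apply/connect1/adj_root.
  case: (eqVneq h c) => [->|hc] //=.
  case: (eqVneq h (flip G c)) => [->|hfc] /=.
    by rewrite connect_adj_sym; apply/connect1/adj_root.
  exact/connect1/adj_root.
have adjc : adj insert_vertex None (Some (root G c)).
  exact: (adj_root insert_vertex (armA H)).
apply: (connected_map (f := Some)) => [h|[w|]]; last 2 first.
- by exists w.
- by exists (root G c); apply: connect1.
have adjfc : connect (adj insert_vertex) None (Some (root G (flip G c))).
  have := adj_root insert_vertex (armB H); rewrite /=.
  by case: (eqVneq (flip G c) c) => [-> _|_ /connect1//]; exact: connect1.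
have adjc' : connect (adj insert_vertex) (Some (root G c)) None.
  by rewrite connect_adj_sym; exact: connect1.
case: (eqVneq h c) => [->|hc]; first exact: connect_trans adjc' adjfc.
case: (eqVneq h (flip G c)) => [->|hfc].
  by rewrite connect_adj_sym flipK; exact: connect_trans adjc' adjfc.
apply: connect1; have := adj_root insert_vertex (old_half h).
by rewrite /= (negbTE hc) (negbTE hfc).
Qed.

Lemma insert_vertex_of_type g n :
  of_type g n.+1 insert_vertex = of_type g n G.
Proof.
rewrite /of_type insert_vertex_connected insert_vertex_card_external eqSS.
rewrite big_option !card_option /=.
congr [&& _, _, _ & _]; last by lia.
apply/forallP/forallP => s v; first by have := s (Some v); rewrite insert_vertex_valence.
by rewrite insert_vertex_valence; case: v => [v|] //=; apply: s.
Qed.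

Lemma insert_vertex_weight :
  weight insert_vertex = tvar^-1 *: (kappa * weight G).
Proof.
rewrite /weight /vertex_product big_option insert_vertex_valence /=.
rewrite vertex_weight03 -scalerAr -exprS scalerA; congr (_ * _ *: kappa ^+ _).
  by apply: eq_bigr => v _; rewrite insert_vertex_valence.
rewrite !card_edges insert_vertex_card_external.
have -> : #|add3 H| = #|H|.+3 by rewrite !card_option.
by have := max_card (external G); lia.
Qed.
End InsertVertex.

(** Recognizes the new vertex after [insert_vertex]. As l is fixed by the
    involution, the last condition says that the edge of a leaves v. *)
Definition corner (V H : finType) (G : graph V H) (v : V) (l a b : H) : bool :=
  [&& uniq [:: l; a; b], vgenus G v == 0%N,
      [forall h, (root G h == v) == (h \in [:: l; a; b])],
      flip G l == l & flip G a \notin [:: a; b]].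

Lemma insert_vertex_corner (V H : finType) (G : graph V H) c :
  corner (insert_vertex G c) None (new_leg H) (armA H) (armB H).
Proof. by apply/and5P; split=> //; apply/forallP => -[[[h|]|]|]. Qed.

Lemma insert_vertex_inj (V H : finType) (G G' : graph V H) c c' :
  insert_vertex G c = insert_vertex G' c' -> G = G' /\ c = c'.
Proof.
move=> e; have ec : c = c' by have [] := congr1 (@flip _ _ ^~ (armA H)) e.
rewrite -{}ec in e *; split=> //; apply: graph_eq => [v|h|h].
- exact: (congr1 (@vgenus _ _ ^~ (Some v)) e).
- by have [] := congr1 (@root _ _ ^~ (old_half h)) e.
have efc : flip G c = flip G' c.
  have := congr1 (@flip _ _ ^~ (armB H)) e; rewrite /=.
  by case: eqVneq => [->|_]; case: eqVneq => [->|_] // [].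
have [->//|hc] := eqVneq h c.
have := congr1 (@flip _ _ ^~ (old_half h)) e; rewrite /= (negbTE hc) -efc.
by case: eqVneq => [->|_ []//]; rewrite flipK efc flipK.
Qed.

(** Removing the trivalent vertex: c is the half-edge joined to arm A, and the
    far end d of arm B, if it is internal, gets joined to c. *)
Lemma insert_vertex_surj (V H : finType) (G : graph (option V) (add3 H)) :
  corner G None (new_leg H) (armA H) (armB H) ->
  exists G' c, (forall v, vgenus G' v = vgenus G (Some v))
               /\ G = insert_vertex G' c.
Proof.
case/and5P=> _ /eqP gN /forallP rN /eqP fl; rewrite !inE negb_or => /andP[fa fab].
have rO h : exists v, root G (old_half h) = Some v.
  case E : (root G (old_half h)) => [v|]; first by exists v.
  by have := rN (old_half h); rewrite E.
have [r rE] := fin_all_exists rO.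
have {}rN x : x \in [:: new_leg H; armA H; armB H] -> root G x = None.
  by move=> xin; have := rN x; rewrite xin => /eqP/eqP.
have [c cE] : exists c, flip G (armA H) = old_half c.
  case E : (flip G (armA H)) fa fab => [[[c|]|]|] //= _ _; first by exists c.
  by have := flipK G (armA H); rewrite E fl.
have cE' : flip G (old_half c) = armA H by rewrite -cE flipK.
have [d [dE d_c]] : exists d, flip G (armB H) = (if d == c then armB H else old_half d)
    /\ (d != c -> flip G (old_half d) = armB H).
  case E : (flip G (armB H)) => [[[d|]|]|].
  - have Ed : flip G (old_half d) = armB H by rewrite /old_half -E flipK.
    by exists d; case: eqVneq => // dc; move: Ed; rewrite dc cE'.
  - by exists c; rewrite eqxx.
  - by have := flipK G (armB H); rewrite E -[Some None]/(armA H) cE.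
  - by have := flipK G (armB H); rewrite E fl.
(* If arm B is external then d = c, and c becomes a fixed point of s. *)
pose s h := if h == c then d else if h == d then c else
  if flip G (old_half h) is Some (Some (Some x)) then x else h.
have sE h : h != c -> h != d -> flip G (old_half h) = old_half (s h).
  move=> hc hd; rewrite /s (negbTE hc) (negbTE hd).
  case E : (flip G (old_half h)) => [[[x|]|]|] //.
  - have := flipK G (old_half h); rewrite E -[Some (Some None)]/(armB H) dE.
    by case: eqVneq => // _ [/eqP]; rewrite eq_sym (negbTE hd).
  - have := flipK G (old_half h); rewrite E -[Some None]/(armA H) cE.
    by case=> /eqP; rewrite eq_sym (negbTE hc).
  - by have := flipK G (old_half h); rewrite E fl.
have sc : s c = d by rewrite /s eqxx.
have sK : involutive s.
  move=> h; case: (eqVneq h c) => [->|hc].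
    by rewrite sc /s eqxx; case: (eqVneq d c).
  case: (eqVneq h d) => [hd|hd].
    by rewrite hd in hc *; rewrite {2}/s (negbTE hc) eqxx sc.
  have e : flip G (old_half (s h)) = old_half h by rewrite -sE ?flipK.
  have shc : s h != c by apply/eqP => shc; rewrite shc cE' in e.
  have shd : s h != d.
    by apply/eqP => shd; rewrite shd in e shc; rewrite d_c in e.
  by rewrite (sE _ shc shd) in e; case: e.
clearbody s.
exists (Graph (fun v => vgenus G (Some v)) r sK), c; split=> //.
apply: graph_eq => [[v|]|[[[h|]|]|]|[[[h|]|]|]] //=.
- exact: rE.
- exact: rN.
- exact: rN.
- exact: rN.
- rewrite sc; case: (eqVneq h c) => [->//|hc].
  case: (eqVneq h d) => [hd|hd]; last exact: sE.
  by rewrite hd in hc *; rewrite d_c.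
- by rewrite sc; exact: dE.
Qed.

(** * Graphs whose marked leg sits on a trivalent vertex *)

Lemma iso_corner (V H V' H' : finType) (G : graph V H) (G' : graph V' H') f k :
  is_iso G G' f k -> forall v l a b,
  corner G' (f v) (k l) (k a) (k b) = corner G v l a b.
Proof.
move=> [bf bk eg er ef] v l a b.
have fI := bij_inj bf; have kI := bij_inj bk; have [k' kK k'K] := bk.
rewrite /corner -[[:: k l; k a; k b]]/(map k [:: l; a; b]) map_inj_uniq // eg.
rewrite !ef (inj_eq kI) -[[:: k a; k b]]/(map k [:: a; b]) mem_map //.
congr [&& _, _, _ & _]; apply/forallP/forallP => rP h.
  by have := rP (k h); rewrite !inE er !(inj_eq kI) (inj_eq fI).
by have := rP (k' h); rewrite -[h]k'K !inE er !(inj_eq kI) (inj_eq fI) kK.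
Qed.

Lemma corner_redundant (V H : finType) (G : graph V H) v l a b :
  corner G v l a b -> (l \in external G) && ~~ redundant_leg G l.
Proof.
case/and5P=> u /eqP gv /forallP rP fl _; rewrite inE fl /= /redundant_leg.
have -> : root G l = v by have := rP l; rewrite !inE eqxx => /eqP/eqP.
have -> : valence G v = 3; last by rewrite gv.
transitivity #|[:: l; a; b]|; last exact/card_uniqP.
by apply: eq_card => h; have := rP h; rewrite [in RHS]inE inE => /eqP.
Qed.

(** Weighting an arm b by 1 + [b external] gives 2 in both cases: if both arms
    are internal, each of the two orders counts once; if one is external, it has
    to be b and counts twice. Connectedness is what excludes arms that both stay
    at v, since v would then be the whole graph and 2g+n = 2. *)
Lemma sum_corners (V H : finType) (G : graph V H) g n l :
  (2 < 2 * g + n)%N -> of_type g n.+1 G -> l \in external G ->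
  ~~ redundant_leg G l ->
  (\sum_v \sum_a \sum_b corner G v l a b * (1 + (b \in external G)) = 2)%N.
Proof.
move=> gn /and4P[cG sG _ /eqP eG]; rewrite inE => /eqP fl.
rewrite /redundant_leg; set v0 := root G l => rl.
pose A := [set h | root G h == v0]%SET.
have cA : #|A| = valence G v0 by [].
have lA : l \in A by rewrite inE.
have vs : (2 * vgenus G v0 + valence G v0 = 3)%N.
  by have /forallP/(_ v0) := sG; move: rl; lia.
(* Some half-edge at v0 lies on an edge that leaves v0: otherwise v0 would be
   the only vertex. *)
have [a0 a0A fa0] : exists2 h, h \in A & flip G h \notin A.
  apply/exists_inP; apply: contraT; rewrite negb_exists_in => /forall_inP clA.
  have VT : [set v0]%SET = [set: V]%SET.
    apply: (connected_closed cG (set11 v0)) => h; rewrite !inE => hv.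
    by have := clA h; rewrite !inE hv => /(_ isT); rewrite negbK.
  have V1 : #|V| = 1%N by rewrite -cardsT -VT cards1.
  have Hv : #|H| = valence G v0.
    rewrite -cA -cardsT; apply: eq_card => h; rewrite !inE; apply/esym/eqP/set1P.
    by rewrite VT inE.
  have : (\sum_v vgenus G v = vgenus G v0)%N.
    transitivity (\sum_(v in [set v0]%SET) vgenus G v)%N; last by rewrite big_set1.
    by rewrite VT; apply: eq_bigl => v; rewrite inE.
  move: eG; lia.
have a0l : a0 != l by apply: contraNneq fa0 => ->; rewrite fl.
have val3 : valence G v0 = 3.
  have : (#|[set a0; l]%SET| <= #|A|)%N.
    by apply/subset_leq_card/fintype.subsetP => h /set2P[]->.
  by rewrite cards2 a0l cA; lia.
have g0 : vgenus G v0 = 0%N by move: vs; lia.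
have /cards1P[b0 Ab] : #|A :\ l :\ a0| == 1%N.
  have := cardsD1 l A; have := cardsD1 a0 (A :\ l).
  by rewrite !inE -/v0 eqxx a0l; move: a0A; rewrite inE => ->; lia.
have AE h : (root G h == v0) = (h \in [:: l; a0; b0]).
  have : (h \in A :\ l :\ a0) = (h == b0) by rewrite Ab inE.
  rewrite !inE => <-; have [->|_] := eqVneq h l; first by rewrite eqxx.
  have [->|_] //= := eqVneq h a0.
  by move: a0A; rewrite inE.
have : b0 \in A :\ l :\ a0 by rewrite Ab set11.
rewrite !inE => /and3P[ba bl bA].
have fa0' : flip G a0 \notin [:: a0; b0].
  apply: contra fa0 => fin; have := AE (flip G a0).
  by rewrite in_cons fin orbT => e; rewrite inE e.
have cornerE v a b : corner G v l a b = (v == v0) &&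
    ((a == a0) && (b == b0) || [&& a == b0, b == a0 & b0 \notin external G]).
  apply/idP/idP.
    move=> /[dup] /and5P[/= u _ /forallP rP _ fa] _.
    have vE : v = v0 by have := rP l; rewrite !inE eqxx => /eqP/eqP.
    subst v; rewrite eqxx /=.
    move: u; rewrite !inE negb_or andbT => /andP[/andP[la lb] ab].
    have arm x : x != l -> x \in [:: l; a; b] -> x = a0 \/ x = b0.
      move=> xl xin; have := rP x; rewrite xin AE !inE (negbTE xl) /=.
      by move=> /eqP/orP[]/eqP; [left|right].
    have la' : a != l by rewrite eq_sym.
    have lb' : b != l by rewrite eq_sym.
    move: ab la lb fa.
    case: (arm a la') => [|->|->]; first by rewrite !inE eqxx orbT.
      case: (arm b lb') => [|->|->]; first by rewrite !inE eqxx !orbT.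
        by rewrite eqxx.
      by rewrite !eqxx.
    case: (arm b lb') => [|->|->]; first by rewrite !inE eqxx !orbT.
      by rewrite !eqxx !inE => _ _ _; case: eqP => //=; rewrite orbT.
    by rewrite eqxx.
  move=> /andP[/eqP -> ab].
  have rP a' b' : [:: a'; b'] =i [:: a0; b0] ->
      [forall h, (root G h == v0) == (h \in [:: l; a'; b'])].
    by move=> e; apply/forallP => h; rewrite AE !(in_cons l) e.
  have al : l != a0 by rewrite eq_sym.
  have lb : l != b0 by rewrite eq_sym.
  have ab0 : a0 != b0 by rewrite eq_sym.
  case/orP: ab => [/andP[/eqP-> /eqP->]|/and3P[/eqP-> /eqP-> fb]].
    apply/and5P; rewrite g0 fl eqxx rP //= !inE !negb_or al lb ab0.
    by move: fa0'; rewrite !inE negb_or.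
  apply/and5P; rewrite g0 fl eqxx rP //=; last by move=> x; rewrite !inE orbC.
  rewrite !inE !negb_or al lb ba; split=> //.
  move: fb; rewrite inE => -> /=; apply: contraNneq fa0' => <-.
  by rewrite flipK !inE eqxx orbT.
rewrite (bigD1 v0) //= [X in (_ + X)%N]big1 ?addn0; last first.
  by move=> v vv; apply: big1 => a _; apply: big1 => b _; rewrite cornerE (negbTE vv).
have ea0 : a0 \notin external G.
  by rewrite inE; apply: contraNneq fa0 => ->.
transitivity (\sum_a \sum_b ((a == a0) * (b == b0) * (1 + (b0 \in external G))
    + (a == b0) * (b == a0) * (b0 \notin external G)))%N.
  apply: eq_bigr => a _; apply: eq_bigr => b _; rewrite cornerE eqxx /=.
  case: (eqVneq a a0) => [->|_] /=.
    rewrite [a0 == b0]eq_sym (negbTE ba) /= orbF mul1n mul0n addn0.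
    by case: (eqVneq b b0) => [->|_]; rewrite ?mul1n ?mul0n.
  rewrite !mul0n add0n; case: (eqVneq a b0) => //= _.
  by case: (eqVneq b a0) => [->|_] /=; rewrite ?mul0n // (negbTE ea0) !mul1n muln1.
under eq_bigr do rewrite big_split /=.
rewrite big_split /=.
have one (x y : H) (m : nat) : (\sum_a \sum_b (a == x) * (b == y) * m = m)%N.
  rewrite (bigD1 x) //= (bigD1 y) //= !eqxx !mul1n !big1 ?addn0 //.
    by move=> a /negbTE->; rewrite big1.
  by move=> b /negbTE->.
by rewrite !one; case: (b0 \in external G).
Qed.

(** * The operator D marks an external edge *)

Section CornerSum.
Variable N : nat.

(** The factor |H| + n counts the half-edges c with multiplicity
    1 + [c external]; it equals 2 (|E| + n). *)
Lemma sum_corner_add3 g n (V H : finType) :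
  \sum_(y : lgraph N (option V) (add3 H) | of_type g n.+1 (graph_of y)
      && corner (graph_of y) None (new_leg H) (armA H) (armB H))
    weight (graph_of y) *+ (1 + (armB H \in external (graph_of y)))
  = (tvar^-1 *: (kappa * total N g n V H)) *+ (#|H| + n).
Proof.
have -> : (tvar^-1 *: (kappa * total N g n V H)) *+ (#|H| + n) =
    \sum_(y : lgraph N V H | of_type g n (graph_of y)) \sum_c
      weight (insert_vertex (graph_of y) c) *+ (1 + (c \in external (graph_of y))).
  rewrite /total mulr_sumr scaler_sumr -sumrMnl; apply: eq_bigr => y yP.
  under eq_bigr do rewrite insert_vertex_weight.
  rewrite sumrMnr; congr (_ *+ _); rewrite big_split /= sum1_card; congr addn.
  have /and4P[_ _ /eqP <- _] := yP.
  rewrite card_externalE; apply: eq_bigr => c _; rewrite inE.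
  by [].
rewrite pair_big /=.
pose psi (p : lgraph N V H * H) := lgraph_of N (insert_vertex (graph_of p.1) p.2).
have psiE p : graph_of (psi p) = insert_vertex (graph_of p.1) p.2.
  by apply: lgraph_ofK => -[v|] //=; exact: graph_of_bound.
rewrite (@sum_bij _ _ _ _ (fun p : lgraph N V H * H => of_type g n (graph_of p.1)) _ psi) //=.
- by apply: eq_big => [p|p _]; rewrite ?andbT ?psiE ?insert_vertex_armB.
- move=> [y v] [y' v'] _ _ /(congr1 (@graph_of _ _ _)); rewrite !psiE /=.
  by move=> /insert_vertex_inj[/graph_of_inj -> ->].
- move=> [y c] /= yP; rewrite psiE /= insert_vertex_corner andbT.
  by rewrite insert_vertex_of_type.
- move=> y /andP[yP /insert_vertex_surj[G' [c [gE e]]]].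
  have labG : graph_of (lgraph_of N G') = G'.
    by apply: lgraph_ofK => v; rewrite gE; exact: graph_of_bound.
  exists (lgraph_of N G', c) => /=.
    by rewrite labG -(insert_vertex_of_type _ c) -e.
  by apply: graph_of_inj; rewrite psiE /= labG e.
Qed.

(** By symmetry the sum is the same for all positions of the corner. *)
Lemma sum_corner g n (V H V' H' : finType) (v : V') (l a b : H') :
  #|V'| = #|V|.+1 -> #|H'| = #|H|.+3 -> uniq [:: l; a; b] ->
  \sum_(y : lgraph N V' H' | of_type g n.+1 (graph_of y)
      && corner (graph_of y) v l a b)
    weight (graph_of y) *+ (1 + (b \in external (graph_of y)))
  = (tvar^-1 *: (kappa * total N g n V H)) *+ (#|H| + n).
Proof.
move=> cV cH u; rewrite -sum_corner_add3.
have [|f bf [fv]] := @bij_extend (option V) V' [:: None] [:: v] _ isT isT erefl.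
  by rewrite card_option.
have [||k bk [kl ka kb]] := @bij_extend (add3 H) H'
    [:: new_leg H; armA H; armB H] [:: l; a; b] _ _ u erefl => //.
  by rewrite !card_option.
pose F (V H : finType) v (l a b : H) (G : graph V H) : Qtk :=
  if of_type g n.+1 G && corner G v l a b
  then weight G *+ (1 + (b \in external G)) else 0.
rewrite [LHS]big_mkcond [RHS]big_mkcond /=; apply/esym.
apply: (@sum_iso N _ _ _ _ _ f k (F _ _ None (new_leg H) (armA H) (armB H))
  (F _ _ v l a b)) => // G G' iso.
rewrite /F -fv -kl -ka -kb (iso_of_type g n.+1 iso) (iso_corner iso).
by rewrite (iso_external iso) (iso_weight iso).
Qed.

Lemma sum_uniq3 h :
  (\sum_(l < h.+3) \sum_(a < h.+3) \sum_(b < h.+3) uniq [:: l; a; b]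
   = h.+3 * (h.+2 * h.+1))%N.
Proof.
rewrite -[h.+3 in RHS](card_ord h.+3) -sum_nat_const; apply: eq_bigr => l _.
transitivity (\sum_(a < h.+3) (a != l) * h.+1)%N; last first.
  rewrite -big_distrl /=; congr muln.
  transitivity #|[set~ l]%SET|; last by rewrite cardsC1 card_ord.
  by rewrite -sum1_card [RHS]big_mkcond; apply: eq_bigr => a _; rewrite !inE; case: eqP.
apply: eq_bigr => a _; have [->|al] := eqVneq a l.
  by rewrite big1 // => b _; rewrite /= !inE eqxx.
transitivity #|~: [set l; a]%SET|; last first.
  by rewrite cardsCs finset.setCK cards2 card_ord [l == a]eq_sym al mul1n; lia.
rewrite -sum1_card [RHS]big_mkcond; apply: eq_bigr => b _.
rewrite /= !inE !negb_or [l == a]eq_sym al [l == b]eq_sym [a == b]eq_sym andbT.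
by case: (b == l); case: (b == a).
Qed.

(** The contribution of one position of the corner, counted twice as in
    [sum_corners]. *)
Definition corner_sum g n v h : Qtk :=
  (tvar^-1 *: (kappa * total N g n 'I_v 'I_h)) *+ (h + n).

Lemma sum_nonredundant_corners g n (V H : finType) : (2 < 2 * g + n)%N ->
  (\sum_(l : H) \sum_(y : lgraph N V H | [&& of_type g n.+1 (graph_of y),
       l \in external (graph_of y) & ~~ redundant_leg (graph_of y) l])
    weight (graph_of y)) *+ 2 =
  \sum_(v : V) \sum_(l : H) \sum_(a : H) \sum_(b : H)
    \sum_(y : lgraph N V H | of_type g n.+1 (graph_of y)
      && corner (graph_of y) v l a b)
    weight (graph_of y) *+ (1 + (b \in external (graph_of y))).
Proof.
move=> gn; rewrite exchange_big /= -sumrMnl; apply: eq_bigr => l _.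
transitivity (\sum_(v : V) \sum_(a : H) \sum_(b : H)
    \sum_(y : lgraph N V H | of_type g n.+1 (graph_of y))
    weight (graph_of y)
      *+ (corner (graph_of y) v l a b * (1 + (b \in external (graph_of y)))));
  last first.
  apply: eq_bigr => v _; apply: eq_bigr => a _; apply: eq_bigr => b _.
  rewrite [RHS]big_mkcondr; apply: eq_bigr => y _.
  by case: (corner _ _ _ _ _); rewrite ?mul1n ?mul0n.
under [RHS]eq_bigr do under eq_bigr do rewrite exchange_big.
under [RHS]eq_bigr do rewrite exchange_big.
rewrite [RHS]exchange_big /= -sumrMnl [LHS]big_mkcond [RHS]big_mkcond /=.
apply: eq_bigr => y _; case: (boolP (of_type g n.+1 (graph_of y))) => //= yP.
under [RHS]eq_bigr do under eq_bigr do rewrite sumrMnr.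
under [RHS]eq_bigr do rewrite sumrMnr.
rewrite [RHS]sumrMnr; case: ifP => [/andP[lE rl]|nl].
  by rewrite (sum_corners gn yP lE rl).
rewrite big1 ?mulr0n // => v _; rewrite big1 // => a _; rewrite big1 // => b _.
by case: (boolP (corner _ _ _ _ _)) => // /corner_redundant; rewrite nl.
Qed.

Lemma sum_nonredundant g n v h : (2 < 2 * g + n)%N ->
  (\sum_(l < h.+3) \sum_(y : lgraph N 'I_v.+1 'I_h.+3 |
      [&& of_type g n.+1 (graph_of y),
       l \in external (graph_of y) & ~~ redundant_leg (graph_of y) l])
    weight (graph_of y)) *+ 2 =
  corner_sum g n v h *+ (v.+1 * (h.+3 * (h.+2 * h.+1))).
Proof.
move=> gn; rewrite sum_nonredundant_corners //.
transitivity (\sum_(v0 < v.+1) \sum_(l < h.+3) \sum_(a < h.+3) \sum_(b < h.+3)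
   corner_sum g n v h *+ uniq [:: l; a; b]).
  apply: eq_bigr => v0 _; apply: eq_bigr => l _; apply: eq_bigr => a _.
  apply: eq_bigr => b _; case: (boolP (uniq [:: l; a; b])) => u; last first.
    by rewrite big1 // => y /andP[_ /and5P[]]; rewrite (negbTE u).
  by rewrite (@sum_corner g n 'I_v 'I_h) ?card_ord.
under eq_bigr do under eq_bigr do under eq_bigr do rewrite sumrMnr.
under eq_bigr do under eq_bigr do rewrite sumrMnr.
under eq_bigr do rewrite sumrMnr sum_uniq3.
by rewrite sumr_const card_ord -mulrnA mulnC.
Qed.

Lemma sum_nonredundant_small g n v h : (2 < 2 * g + n)%N ->
  (v == 0)%N || (h < 3)%N ->
  \sum_(l < h) \sum_(y : lgraph N 'I_v 'I_h |
      [&& of_type g n.+1 (graph_of y),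
       l \in external (graph_of y) & ~~ redundant_leg (graph_of y) l])
    weight (graph_of y) = 0.
Proof.
move=> gn small; apply/eqP; have : ((2%:R : Qt) != 0) by rewrite natQt_eq0.
move=> /negbTE n2; rewrite -[_ == 0]orFb -{1}n2 -scaler_eq0 scaler_nat.
rewrite sum_nonredundant_corners // big1 // => v0 _; rewrite big1 // => l _.
rewrite big1 // => a _; rewrite big1 // => b _; rewrite big1 // => y.
case/andP=> _ /and5P[u _ _ _ _]; have := card_uniqP u => c3.
have := max_card (mem [:: l; a; b]); rewrite c3 card_ord /=.
case/orP: small => [/eqP v00|h3]; last by rewrite leqNgt h3.
by have := ltn_ord v0; rewrite [X in (_ < X)%N]v00.
Qed.

Lemma total_marked g n v h :
  total N g n.+1 'I_v 'I_h *+ n.+1 =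
  \sum_(l < h) \sum_(y : lgraph N 'I_v 'I_h | [&& of_type g n.+1 (graph_of y),
       l \in external (graph_of y) & redundant_leg (graph_of y) l])
    weight (graph_of y) +
  \sum_(l < h) \sum_(y : lgraph N 'I_v 'I_h | [&& of_type g n.+1 (graph_of y),
       l \in external (graph_of y) & ~~ redundant_leg (graph_of y) l])
    weight (graph_of y).
Proof.
rewrite -big_split /=.
transitivity (\sum_(l < h) \sum_(y : lgraph N 'I_v 'I_h | of_type g n.+1 (graph_of y))
   weight (graph_of y) *+ (l \in external (graph_of y))).
  rewrite exchange_big /= -sumrMnl; apply: eq_bigr => y /and4P[_ _ /eqP <- _].
  rewrite sumrMnr; congr (_ *+ _); rewrite card_externalE.
  by apply: eq_bigr => h' _; rewrite inE.
apply: eq_bigr => l _; rewrite [X in _ = X + _]big_mkcondr [X in _ = _ + X]big_mkcondr.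
rewrite -big_split /=; apply: eq_bigr => y _.
by case: (l \in _); case: (redundant_leg _ _); rewrite ?addr0 ?add0r.
Qed.

Lemma rescale_double (a b : nat) (x y : Qtk) k :
  x *+ 2 = y *+ k -> (a = k * b)%N -> (0 < k)%N ->
  a%:R^-1 *: x = b%:R^-1 *: (2%:R^-1 *: y).
Proof.
move=> e -> k0; have k0' : (k%:R : Qt) != 0 by rewrite natQt_eq0 -lt0n.
have n2 : (2%:R : Qt) != 0 by rewrite natQt_eq0.
have -> : x = 2%:R^-1 *: (k%:R *: y) by rewrite scaler_nat -e -scaler_nat scalerK.
rewrite natrM invfM !scalerA; congr (_ *: _).
by rewrite mulrC !mulrA mulfV // mul1r.
Qed.

Lemma rescale_mulrn (a b k : nat) (x : Qtk) :
  (a = k * b)%N -> (0 < k)%N -> a%:R^-1 *: (x *+ k) = b%:R^-1 *: x.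
Proof.
move=> -> k0; have k0' : (k%:R : Qt) != 0 by rewrite natQt_eq0 -lt0n.
by rewrite -scaler_nat scalerA natrM invfM mulrC mulrA mulfV // mul1r.
Qed.

Lemma corner_coefficient (F : fieldType) (ti c e m : F) : 2%:R != 0 :> F ->
  2%:R^-1 * (2%:R * (e + m)) * (ti * c) = ti * c * e + m * ti * c.
Proof. by move=> n2; field. Qed.

(** The part of D other than d/dt: |E| is produced by the Euler operator
    kappa d/dkappa. *)
Lemma corner_sum_euler g n v h : 2%:R^-1 *: corner_sum g n v h =
  tvar^-1 *: (kappa ^+ 2 * d_kappa (total N g n 'I_v 'I_h))
  + (n%:R / tvar) *: (kappa * total N g n 'I_v 'I_h).
Proof.
rewrite /corner_sum /total /d_kappa raddf_sum !mulr_sumr !scaler_sumr.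
rewrite -sumrMnl scaler_sumr -big_split /=; apply: eq_bigr => y yP.
have hE : (h + n = 2 * (#|edges (graph_of y)| + n))%N.
  have := card_half_edges (graph_of y); have /and4P[_ _ /eqP-> _] := yP.
  by rewrite card_ord; lia.
rewrite /weight hE; move: (vertex_product _) #|edges _| => c e.
rewrite derivZ derivXn -!scalerAr !scalerA mulrnAr.
have -> : kappa ^+ 2 * 'X^(e.-1) *+ e = e%:R *: kappa ^+ e.+1 :> Qtk.
  case: e => [|e]; first by rewrite mulr0n scale0r.
  by rewrite -exprD scaler_nat.
rewrite -exprS -scaler_nat !scalerA -scalerDl; congr (_ *: _).
by rewrite natrM natrD; apply: corner_coefficient; rewrite natQt_eq0.
Qed.

(** Each of the n+1 external edges of a graph is marked once; the marked leg is
    redundant or sits on a corner. *)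
Lemma chi_marked g n : (2 < 2 * g + n)%N -> (6 * g + 3 * n.+1 <= N)%N ->
  chi g n.+1 *+ n.+1 = Dop n (chi g n).
Proof.
move=> gn gN; pose M := (6 * g + 3 * n.+1)%N.
rewrite (@chi_total N g n.+1 M.+1 M.+3.+3); [|lia..].
transitivity (\sum_(v < M.+1) \sum_(h < M.+3.+3)
   (v`! * h`!)%:R^-1 *: (total N g n.+1 'I_v 'I_h *+ n.+1)).
  rewrite -sumrMnl; apply: eq_bigr => v _; rewrite -sumrMnl; apply: eq_bigr => h _.
  by rewrite scalerMnr.
under eq_bigr do under eq_bigr do rewrite total_marked scalerDr.
under eq_bigr do rewrite big_split /=.
rewrite big_split /= /Dop /dop -addrA; congr (_ + _).
  rewrite (@chi_total N g n M.+1 M.+3.+2); [|lia..].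
  rewrite raddf_sum; apply: eq_bigr => v _.
  rewrite big_ord_recl big_ord0 scaler0 add0r raddf_sum; apply: eq_bigr => h _.
  rewrite sum_redundant /= d_t_natVZ.
  by apply: rescale_mulrn => //; rewrite factS; lia.
rewrite (@chi_total N g n M M.+3); [|lia..].
rewrite /d_kappa raddf_sum !mulr_sumr !scaler_sumr -big_split /=.
(* A corner takes up one vertex and three half-edges. *)
rewrite big_ord_recl /= big1 ?add0r; last first.
  by move=> h _; rewrite sum_nonredundant_small ?scaler0.
apply: eq_bigr => v _; rewrite raddf_sum !mulr_sumr !scaler_sumr -big_split /=.
do 3 rewrite [in LHS]big_ord_recl; rewrite /= !sum_nonredundant_small ?orbT // !scaler0 !add0r.
have scC (a c : Qt) (k p : Qtk) : a *: (k * (c *: p)) = c *: (a *: (k * p)).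
  by rewrite -scalerAr !scalerA mulrC.
apply: eq_bigr => h _; rewrite derivZ !scC -scalerDr -corner_sum_euler.
apply: rescale_double (sum_nonredundant _ _ gn) _ _ => //.
by rewrite /bump /= !factS; lia.
Qed.
End CornerSum.

(** * Cutting and gluing *)

Section Toggle.
Variables (V H : finType) (G : graph V H) (c d : H).

(** One operation for cutting and gluing: composing the involution with the
    transposition (c d) joins c and d if both are external, and separates them
    if they form an edge. For other pairs the composite need not be
    an involution, and the graph is left unchanged. *)
Definition toggle_flip (x : H) : H :=
  if (flip G c == c) && (flip G d == d) || (flip G c == d)
  then flip G (tperm c d x) else flip G x.

Fact toggle_flipK : involutive toggle_flip.
Proof.
move=> x; rewrite /toggle_flip; set b := _ || _.
case: (boolP b) => [cd|_]; last exact: (flipK G).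
have tf y : tperm c d (flip G y) = flip G (tperm c d y).
  have fI := can_inj (flipK G).
  case/orP: cd => [/andP[/eqP fc /eqP fd]|/eqP fc].
    case: tpermP => [e|e|nc nd].
    - by have -> : y = c; [rewrite -[y](flipK G) e|rewrite tpermL fd].
    - by have -> : y = d; [rewrite -[y](flipK G) e|rewrite tpermR fc].
    - by rewrite tpermD //; apply/eqP => e; [apply: nc|apply: nd]; rewrite -e.
  have fd : flip G d = c by rewrite -fc flipK.
  case: tpermP => [e|e|nc nd].
  - by have -> : y = d; [rewrite -[y](flipK G) e|rewrite tpermR fc].
  - by have -> : y = c; [rewrite -[y](flipK G) e|rewrite tpermL fd].
  - by rewrite tpermD //; apply/eqP => e; [apply: nd|apply: nc]; rewrite -e.
by rewrite tf flipK tpermK.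
Qed.

Definition toggle : graph V H := Graph (vgenus G) (root G) toggle_flipK.

Lemma toggle_stable : stable toggle = stable G.
Proof. by []. Qed.

Lemma toggle_vertex_product : vertex_product toggle = vertex_product G.
Proof. by []. Qed.
End Toggle.

Lemma iso_toggle (V H V' H' : finType) (G : graph V H) (G' : graph V' H') f k c d :
  is_iso G G' f k -> is_iso (toggle G c d) (toggle G' (k c) (k d)) f k.
Proof.
move=> [bf bk eg er ef]; split=> // x /=; rewrite /toggle_flip.
have kI := bij_inj bk.
by rewrite !ef !(inj_eq kI) -inj_tperm //; set b := _ || _; case: b.
Qed.

Section Glue.
Variables (V H : finType) (G : graph V H) (c d : H).
Hypotheses (cd : c != d) (cE : c \in external G) (dE : d \in external G).

Lemma glue_flipE x :
  flip (toggle G c d) x = if x == c then d else if x == d then c else flip G x.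
Proof.
move: cE dE; rewrite !inE => fc fd; rewrite /= /toggle_flip fc fd /=.
case: tpermP => [->|->|/eqP/negbTE nc /eqP/negbTE nd]; last by rewrite nc nd.
  by rewrite eqxx (eqP fd).
by rewrite eq_sym (negbTE cd) eqxx (eqP fc).
Qed.

Lemma glueK : toggle (toggle G c d) c d = G.
Proof.
have Tc : flip (toggle G c d) c = d by rewrite glue_flipE eqxx.
apply: graph_eq => // x; move: Tc (glue_flipE); move: (toggle G c d) => T Tc TE.
rewrite /= /toggle_flip Tc eqxx orbT TE.
move: cE dE; rewrite !inE => /eqP fc /eqP fd.
case: tpermP => [->|->|/eqP/negbTE -> /eqP/negbTE -> //]; rewrite ?eqxx //.
by rewrite eq_sym (negbTE cd).
Qed.

Lemma card_external_glue : #|external G| = #|external (toggle G c d)|.+2.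
Proof.
rewrite (cardsD1 c) (cardsD1 d) cE !inE eq_sym cd /=.
move: dE; rewrite inE => ->; congr (_.+2); apply: eq_card => x.
rewrite !in_setD1 !inE; have := glue_flipE x; rewrite /= => ->.
have [->|xc] := eqVneq x c; first by rewrite /= andbF [d == c]eq_sym (negbTE cd).
by have [->|xd] := eqVneq x d; first by rewrite /= (negbTE cd).
Qed.

Lemma connected_glue : connected G -> connected (toggle G c d).
Proof.
apply: (connected_map (f := id)) => [h|w]; last by exists w.
move: cE dE; rewrite !inE => /eqP fc /eqP fd.
have [->|hc] := eqVneq h c; first by rewrite fc.
have [->|hd] := eqVneq h d; first by rewrite fd.
have := adj_root (toggle G c d) h; rewrite glue_flipE (negbTE hc) (negbTE hd).
exact: connect1.
Qed.

(** If gluing c to d produces a connected graph, there were at most two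
    components, those of the roots of c and d. *)
Lemma connect_glue_ends w : connected (toggle G c d) ->
  connect (adj G) (root G c) w || connect (adj G) (root G d) w.
Proof.
move=> cT; pose S := [set w | connect (adj G) (root G c) w
                              || connect (adj G) (root G d) w]%SET.
have rS x : x \in S -> forall y, connect (adj G) x y -> y \in S.
  rewrite !inE => /orP[] xS y xy; rewrite inE.
    by rewrite (connect_trans xS xy).
  by rewrite (connect_trans xS xy) orbT.
have cS : root G c \in S by rewrite inE connect0.
have dS : root G d \in S by rewrite inE connect0 orbT.
have : w \in S; last by rewrite inE.
rewrite (connected_closed cT cS) ?inE // => h hS.
rewrite glue_flipE; case: eqP => // _; case: eqP => // _.
exact: rS hS _ (connect1 (adj_root G h)).
Qed.
End Glue.

Section Cut.
Variables (V H : finType) (G : graph V H) (c : H).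
Hypothesis cI : c \notin external G.

Lemma cut_flipE x : flip (toggle G c (flip G c)) x =
  if (x == c) || (x == flip G c) then x else flip G x.
Proof.
rewrite /= /toggle_flip eqxx orbT.
by case: tpermP => [->|->|/eqP/negbTE -> /eqP/negbTE -> //]; rewrite ?eqxx ?orbT ?flipK.
Qed.

Lemma cut_external : (c \in external (toggle G c (flip G c))) &&
  (flip G c \in external (toggle G c (flip G c))).
Proof. by rewrite !inE !cut_flipE !eqxx orbT !eqxx. Qed.

Lemma cutK : toggle (toggle G c (flip G c)) c (flip G c) = G.
Proof.
have /andP[cE fE] := cut_external.
have cf : c != flip G c by move: cI; rewrite inE eq_sym.
apply: graph_eq => // x; rewrite glue_flipE // cut_flipE.
by case: eqP => [->//|]; case: eqP => [->|]; rewrite ?flipK.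
Qed.
End Cut.

Section CutSum.
Variable N : nat.

(** Gluing c to d puts the terms in bijection with the graphs of type (g,n) with
    a marked half of an internal edge; P selects a class of cut graphs. *)
Definition glued_sum (g n : nat) (V H : finType) (P : graph V H -> H -> H -> bool) : Qtk :=
  \sum_(p : lgraph N V H * (H * H) |
      [&& p.2.1 != p.2.2, p.2.1 \in external (graph_of p.1),
          p.2.2 \in external (graph_of p.1),
          of_type g n (toggle (graph_of p.1) p.2.1 p.2.2)
        & P (graph_of p.1) p.2.1 p.2.2])
    weight (graph_of p.1).

(** Lowering the exponent of kappa by one accounts for the cut edge, and the
    coefficient 2 |E| for the choice of one of its halves as c. *)
Lemma d_kappa_total g n (V H : finType) :
  d_kappa (total N g n V H) *+ 2 = glued_sum g n (fun (_ : graph V H) _ _ => true).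
Proof.
transitivity (\sum_(p : lgraph N V H * H | of_type g n (graph_of p.1)
      && (p.2 \notin external (graph_of p.1)))
    weight (toggle (graph_of p.1) p.2 (flip (graph_of p.1) p.2))).
  rewrite /total /d_kappa raddf_sum /= -sumrMnl.
  rewrite -(pair_big_dep (fun y : lgraph N V H => of_type g n (graph_of y))
    (fun y c => c \notin external (graph_of y))
    (fun y c => weight (toggle (graph_of y) c (flip (graph_of y) c)))) /=.
  apply: eq_bigr => y yP; set G := graph_of y.
  rewrite (eq_bigr (fun=> vertex_product G *: kappa ^+ (#|edges G|.-1))).
    rewrite sumr_const.
    have -> : #|[pred c | c \notin external G]| = (#|edges G| * 2)%N.
      have -> : #|[pred c | c \notin external G]| = #|~: external G|.
        by apply: eq_card => h; rewrite !inE.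
      have := card_half_edges G; have := cardsC (external G); lia.
    by rewrite /weight derivZ derivXn mulrnA -scalerMnr.
  move=> c cI; rewrite /weight toggle_vertex_product !card_edges.
  have /andP[cE fE] := cut_external G c.
  have cf : c != flip G c by move: cI; rewrite inE eq_sym.
  rewrite (card_external_glue cf cE fE) cutK //.
  by congr (_ *: _ ^+ _); lia.
pose psi (p : lgraph N V H * (H * H)) : lgraph N V H * H :=
  (lgraph_of N (toggle (graph_of p.1) p.2.1 p.2.2), p.2.1).
have psiE p : graph_of (psi p).1 = toggle (graph_of p.1) p.2.1 p.2.2.
  by apply: lgraph_ofK => v; exact: graph_of_bound.
rewrite /glued_sum (@sum_bij _ _ _ _ (fun p : lgraph N V H * (H * H) =>
  [&& p.2.1 != p.2.2, p.2.1 \in external (graph_of p.1),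
          p.2.2 \in external (graph_of p.1) &
          of_type g n (toggle (graph_of p.1) p.2.1 p.2.2)]) _ psi).
- apply: eq_big => [p|[y [c d]] yP]; first by rewrite andbT.
  rewrite psiE; move: yP => /and4P[/= cd cE dE _].
  by have := glue_flipE cd cE dE c; rewrite /= eqxx => ->; rewrite glueK.
- move=> [y [c d]] [y' [c' d']] /and4P[/= cd cE dE _] /and4P[/= cd' cE' dE' _] e.
  have ec : c = c' by have := congr1 snd e.
  have := congr1 (fun p => graph_of p.1) e; rewrite !psiE /= => {}e; subst c'.
  have := congr1 (fun G => flip G c) e; rewrite !glue_flipE // eqxx => ed; subst d'.
  have := congr1 (fun G => toggle G c d) e; rewrite !glueK // => {}e.
  by congr (_, _); apply: graph_of_inj.
- move=> [y [c d]] yP; rewrite psiE; move: yP => /and4P[/= cd cE dE ->] /=.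
  by have := glue_flipE cd cE dE c; rewrite inE /= eqxx => ->; rewrite eq_sym.
- move=> [y c] /= /andP[yP cI]; set G := graph_of y in yP cI *.
  have labG : graph_of (lgraph_of N (toggle G c (flip G c))) = toggle G c (flip G c).
    by apply: lgraph_ofK => v; exact: graph_of_bound.
  exists (lgraph_of N (toggle G c (flip G c)), (c, flip G c)).
    rewrite /= labG; have /andP[-> ->] := cut_external G c.
    by rewrite cutK // yP !andbT; move: cI; rewrite inE eq_sym.
  by congr (_, _); apply: graph_of_inj; rewrite psiE /= labG cutK.
Qed.
End CutSum.

(** * Cut graphs, connected or not *)

Section Separation.
Variables (V H : finType).
Implicit Types (G : graph V H) (A : {set V}) (B : {set H}).

(** The graph is the disjoint union of a graph on A and B that carries c and a
    graph on the complements that carries d. *)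
Definition separates A B G (c d : H) : bool :=
  [&& [forall h, ((root G h \in A) == (h \in B))
                 && ((flip G h \in B) == (h \in B))],
      c \in B & d \notin B].

(** If G is connected nothing separates c from d. If not, the component of the
    root of c is the only possible A, by [connect_glue_ends]. *)
Lemma count_separations G c d :
  c != d -> c \in external G -> d \in external G ->
  connected (toggle G c d) ->
  (\sum_A \sum_B separates A B G c d = ~~ connected G)%N.
Proof.
move=> cd cE dE cT.
have sepP A B : separates A B G c d ->
    [/\ forall h, (root G h \in A) = (h \in B), closed (adj G) A,
        root G c \in A & root G d \notin A].
  case/and3P=> /forallP sAB cB dB.
  have rB h : (root G h \in A) = (h \in B) by have /andP[/eqP] := sAB h.
  split; rewrite ?rB // => x y /existsP[h /andP[/eqP <- /eqP <-]].
  by rewrite !rB; have /andP[_ /eqP ->] := sAB h.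
have [cG|ncG] /= := boolP (connected G).
  apply: big1 => A _; apply: big1 => B _; apply/eqP; rewrite eqb0.
  apply/negP => /sepP[_ clA cA]; rewrite -(closed_connect clA (x := root G c)) ?cA //.
  have /connectedP[v cv] := cG; apply: connect_trans (cv _).
  by rewrite connect_adj_sym.
pose A0 := [set v | connect (adj G) (root G c) v]%SET.
pose B0 := [set h | root G h \in A0]%SET.
(* By [connect_glue_ends] a vertex outside the component A0 of c is connected
   to d. *)
have sep0 A B : separates A B G c d = (A == A0) && (B == B0).
  apply/idP/andP => [/sepP[rB clA cA dA]|[/eqP -> /eqP ->]].
    have AE : A = A0.
      apply/setP => w; rewrite inE; apply/idP/idP => [wA|cw].
        case/orP: (connect_glue_ends cd cE dE w cT) => // dw.
        by rewrite (closed_connect clA dw) wA in dA.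
      by rewrite -(closed_connect clA cw).
    split; apply/eqP => //; apply/setP => h.
    by rewrite !inE -rB AE inE.
  apply/and3P; split.
  - apply/forallP => h; rewrite !inE eqxx /=.
    by rewrite (same_connect_r (connect_adj_sym G) (connect1 (adj_root G h))).
  - by rewrite !inE connect0.
  - rewrite !inE; apply: contra ncG => cd'; apply/connectedP; exists (root G c) => w.
    by case/orP: (connect_glue_ends cd cE dE w cT) => // dw; apply: connect_trans dw.
rewrite (bigD1 A0) //= (bigD1 B0) //= sep0 !eqxx !big1 //.
- by move=> A /negbTE nA; rewrite big1 // => B _; rewrite sep0 nA.
- by move=> B /negbTE nB; rewrite sep0 nB andbF.
Qed.
End Separation.

Section GluedSum.
Variable N : nat.

Lemma glued_sumE g n (V H : finType) (P : graph V H -> H -> H -> bool) :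
  glued_sum N g n P = \sum_(y : lgraph N V H) \sum_(cd : H * H)
    weight (graph_of y) *+ [&& cd.1 != cd.2, cd.1 \in external (graph_of y),
          cd.2 \in external (graph_of y),
          of_type g n (toggle (graph_of y) cd.1 cd.2)
        & P (graph_of y) cd.1 cd.2].
Proof.
rewrite pair_bigA /glued_sum big_mkcond /=.
by apply: eq_bigr => p _; case: ifP.
Qed.

Lemma glued_sum_iso g n (V H V' H' : finType) f k
    (P : graph V H -> H -> H -> bool) (P' : graph V' H' -> H' -> H' -> bool) :
  bijective f -> bijective k ->
  (forall G G', is_iso G G' f k -> forall c d, P G c d = P' G' (k c) (k d)) ->
  glued_sum N g n P = glued_sum N g n P'.
Proof.
move=> bf bk PP'; rewrite !glued_sumE.
pose F (V H : finType) (P : graph V H -> H -> H -> bool) (G : graph V H) : Qtk :=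
  \sum_(cd : H * H) weight G *+ [&& cd.1 != cd.2, cd.1 \in external G,
          cd.2 \in external G, of_type g n (toggle G cd.1 cd.2) & P G cd.1 cd.2].
apply: (@sum_iso N _ _ _ _ _ f k (F _ _ P) (F _ _ P')) => // G G' iso.
have [k' kK k'K] := bk.
rewrite /F [RHS](reindex (fun p : H * H => (k p.1, k p.2))) /=; last first.
  exists (fun p => (k' p.1, k' p.2)) => -[c d] _ /=; by rewrite ?kK ?k'K.
apply: eq_bigr => -[c d] _ /=; rewrite (iso_weight iso) !(iso_external iso).
by rewrite (inj_eq (bij_inj bk)) (iso_of_type g n (iso_toggle c d iso)) (PP' _ _ iso).
Qed.

Lemma glued_sum_cases g n (V H : finType) :
  glued_sum N g n (fun (_ : graph V H) _ _ => true) =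
  glued_sum N g n (fun (G : graph V H) _ _ => connected G)
  + \sum_(A : {set V}) \sum_(B : {set H}) glued_sum N g n (separates A B).
Proof.
rewrite !glued_sumE; under [X in _ = _ + X]eq_bigr do under eq_bigr do rewrite glued_sumE.
under [X in _ = _ + X]eq_bigr do rewrite exchange_big.
rewrite [X in _ = _ + X]exchange_big /= -big_split /=; apply: eq_bigr => y _.
under [X in _ = _ + X]eq_bigr do rewrite exchange_big.
rewrite [X in _ = _ + X]exchange_big /= -big_split /=; apply: eq_bigr => -[c d] _ /=.
under [X in _ = _ + X]eq_bigr do rewrite sumrMnr.
rewrite sumrMnr -mulrnDr; congr (_ *+ _).
case: (boolP (c == d)) => [|cd] /=; first by rewrite add0n big1 // => A _; rewrite big1.
case: (boolP (c \in _)) => [cE|] /=; last by rewrite add0n big1 // => A _; rewrite big1.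
case: (boolP (d \in _)) => [dE|] /=; last by rewrite add0n big1 // => A _; rewrite big1.
case: (boolP (of_type _ _ _)) => [/and4P[cT _ _ _]|] /=.
  by rewrite count_separations //; case: (connected _).
by rewrite add0n big1 // => A _; rewrite big1.
Qed.

(** Gluing two external edges of a connected graph raises the genus by one. In
    genus 0 it is impossible by [spanning_tree_bound]. *)
Lemma glue_of_type (V H : finType) (G : graph V H) c d g n :
  c != d -> c \in external G -> d \in external G -> connected G ->
  of_type g n (toggle G c d) = if g is h.+1 then of_type h n.+2 G else false.
Proof.
move=> cd cE dE cG; have := spanning_tree_bound cG.
rewrite /of_type (connected_glue cd cE dE cG) toggle_stable cG /=.
rewrite (card_external_glue cd cE dE).
case: (boolP (stable G)) => [_|_]; last by case: g.
rewrite /=; case: (eqVneq #|external (toggle G c d)| n) => [->|ne] /=; last first.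
  by case: g => // g; rewrite !eqSS (negbTE ne).
case: g => [|g]; first by move=> b; apply/negbTE; lia.
by rewrite eqxx /= => _; lia.
Qed.

Lemma sum_distinct_pairs (T : finType) (A : {set T}) :
  (\sum_(cd : T * T) [&& cd.1 != cd.2, cd.1 \in A & cd.2 \in A]
   = #|A| * #|A|.-1)%N.
Proof.
transitivity (\sum_c \sum_d [&& c != d, c \in A & d \in A])%N.
  by rewrite pair_bigA.
rewrite -sum_nat_const [RHS]big_mkcond; apply: eq_bigr => c _.
case: (boolP (c \in A)) => [cA|_]; last by rewrite big1 // => d _; rewrite andbF.
rewrite (cardsD1 c) cA /= -sum1_card [RHS]big_mkcond; apply: eq_bigr => d _.
by rewrite !inE eq_sym; case: (d == c); case: (d \in A).
Qed.

Lemma glued_sum_connected g n (V H : finType) :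
  glued_sum N g n (fun (G : graph V H) _ _ => connected G) =
  (if g is h.+1 then total N h n.+2 V H else 0) *+ (n.+2 * n.+1).
Proof.
rewrite glued_sumE.
transitivity (\sum_(y : lgraph N V H |
    if g is h.+1 then of_type h n.+2 (graph_of y) else false)
    weight (graph_of y) *+ (n.+2 * n.+1)); last first.
  by case: g => [|g]; rewrite ?big_pred0_eq ?mul0rn // -sumrMnl.
rewrite [RHS]big_mkcond; apply: eq_bigr => y _; rewrite sumrMnr.
have [cG|ncG] := boolP (connected (graph_of y)); last first.
  rewrite big1; last by move=> cd _; rewrite !andbF.
  by case: g => // g; rewrite /of_type (negbTE ncG).
transitivity (weight (graph_of y) *+ (
   (if g is h.+1 then of_type h n.+2 (graph_of y) else false) * \sum_(cd : H * H)
   [&& cd.1 != cd.2, cd.1 \in external (graph_of y) & cd.2 \in external (graph_of y)])).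
  congr (_ *+ _); rewrite big_distrr /=; apply: eq_bigr => -[c d] _ /=; rewrite andbT.
  case: (boolP (c == d)) => [|cd] /=; first by rewrite muln0.
  case: (boolP (c \in _)) => [cE|] /=; last by rewrite muln0.
  case: (boolP (d \in _)) => [dE|] /=; last by rewrite muln0.
  by rewrite glue_of_type // muln1; case: (g).
rewrite sum_distinct_pairs; case: g => [|g] //.
by case: (boolP (of_type _ _ _)) => // /and4P[_ _ /eqP -> _]; rewrite mul1n.
Qed.
End GluedSum.

(** * Disjoint unions *)

Section Union.
Variables (V1 H1 V2 H2 : finType) (G1 : graph V1 H1) (G2 : graph V2 H2).

Definition sum_map (A1 B1 A2 B2 : Type) (f1 : A1 -> B1) (f2 : A2 -> B2)
    (x : A1 + A2) : B1 + B2 :=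
  match x with inl a => inl (f1 a) | inr a => inr (f2 a) end.

Fact union_flipK : involutive (sum_map (flip G1) (flip G2)).
Proof. by case=> h /=; rewrite flipK. Qed.

Definition union_graph : graph (V1 + V2)%type (H1 + H2)%type :=
  Graph (fun v => match v with inl v => vgenus G1 v | inr v => vgenus G2 v end)
    (sum_map (root G1) (root G2)) union_flipK.

Lemma union_valence v : valence union_graph v =
  match v with inl v => valence G1 v | inr v => valence G2 v end.
Proof.
rewrite valenceE big_sumType /=; case: v => v /=; rewrite valenceE.
  rewrite [X in (_ + X)%N]big1 ?addn0 //.
by rewrite big1.
Qed.

Lemma union_card_external :
  #|external union_graph| = (#|external G1| + #|external G2|)%N.
Proof. by rewrite !card_externalE big_sumType. Qed.

Lemma union_external_inl h : (inl h \in external union_graph) = (h \in external G1).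
Proof. by rewrite !inE. Qed.

Lemma union_external_inr h : (inr h \in external union_graph) = (h \in external G2).
Proof. by rewrite !inE. Qed.

Lemma union_stable : stable union_graph = stable G1 && stable G2.
Proof.
apply/forallP/andP => [s|[/forallP s1 /forallP s2] v].
  by split; apply/forallP => v; [have := s (inl v)|have := s (inr v)];
    rewrite union_valence.
by rewrite union_valence; case: v => v /=; [exact: s1|exact: s2].
Qed.

Lemma union_weight : weight union_graph = weight G1 * weight G2.
Proof.
rewrite /weight -scalerAl -scalerAr scalerA -exprD; congr (_ *: _ ^+ _).
  rewrite /vertex_product big_sumType /=.
  by congr (_ * _); apply: eq_bigr => v _; rewrite union_valence.
rewrite !card_edges union_card_external card_sum.
have [k1 ->] : exists k, #|H1| = (#|external G1| + 2 * k)%N.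
  by exists #|edges G1|; exact: card_half_edges.
have [k2 ->] : exists k, #|H2| = (#|external G2| + 2 * k)%N.
  by exists #|edges G2|; exact: card_half_edges.
by lia.
Qed.

Variables (h1 : H1) (h2 : H2).
Hypotheses (h1E : h1 \in external G1) (h2E : h2 \in external G2).
Let T := toggle union_graph (inl h1) (inr h2).

Let TE := @glue_flipE _ _ union_graph (inl h1) (inr h2) isT
  (etrans (union_external_inl h1) h1E) (etrans (union_external_inr h2) h2E).

(** For the direct implication, a path of the glued graph is projected to one
    side by contracting the other side to the end of the bridge. *)
Lemma union_toggle_connected : connected T = connected G1 && connected G2.
Proof.
move: (h1E) (h2E); rewrite !inE => /eqP f1 /eqP f2.
apply/idP/andP => [cT|[c1 c2]].
  split.
    apply: (connected_map (f := fun v => match v with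
      | inl v => v | inr _ => root G1 h1 end)) cT => [h|w]; last by exists (inl w).
    rewrite TE; case: (eqVneq h (inl h1)) => [->|hc]; first exact: connect0.
    case: (eqVneq h (inr h2)) => [->|hd]; first exact: connect0.
    by case: h {hc hd} => h /=; rewrite ?connect0 //; apply/connect1/adj_root.
  apply: (connected_map (f := fun v => match v with
    | inl _ => root G2 h2 | inr v => v end)) cT => [h|w]; last by exists (inr w).
  rewrite TE; case: (eqVneq h (inl h1)) => [->|hc]; first exact: connect0.
  case: (eqVneq h (inr h2)) => [->|hd]; first exact: connect0.
  by case: h {hc hd} => h /=; rewrite ?connect0 //; apply/connect1/adj_root.
have bridge : adj T (inl (root G1 h1)) (inr (root G2 h2)).
  by have := adj_root T (inl h1); rewrite TE eqxx.
have c1T v w : connect (adj G1) v w -> connect (adj T) (inl v) (inl w).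
  apply: connect_homo => x y /existsP[h /andP[/eqP <- /eqP <-]].
  have [->|hh] := eqVneq h h1; first by rewrite f1.
  by have := adj_root T (inl h); rewrite TE /= (inj_eq inl_inj) (negbTE hh); exact: connect1.
have c2T v w : connect (adj G2) v w -> connect (adj T) (inr v) (inr w).
  apply: connect_homo => x y /existsP[h /andP[/eqP <- /eqP <-]].
  have [->|hh] := eqVneq h h2; first by rewrite f2.
  by have := adj_root T (inr h); rewrite TE /= (inj_eq inr_inj) (negbTE hh); exact: connect1.
have all1 v w : connect (adj G1) v w.
  have /connectedP[u cu] := c1.
  by apply: connect_trans (cu w); rewrite connect_adj_sym.
have all2 v w : connect (adj G2) v w.
  have /connectedP[u cu] := c2.
  by apply: connect_trans (cu w); rewrite connect_adj_sym.
apply/connectedP; exists (inl (root G1 h1)) => -[w|w]; first exact: c1T.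
exact: connect_trans (connect1 bridge) (c2T _ _ (all2 _ _)).
Qed.

End Union.

(** The genus of a connected graph as a natural number. *)
Lemma of_type_unique (V H : finType) (G : graph V H) :
  connected G -> stable G -> exists g0, forall g n,
    of_type g n G = (g == g0) && (n == #|external G|).
Proof.
move=> cG sG; have tG := spanning_tree_bound cG.
have [e hG] : exists e, #|H| = (#|external G| + 2 * e)%N.
  by exists #|edges G|; exact: card_half_edges.
exists ((\sum_v vgenus G v) + e + 1 - #|V|)%N => g n.
rewrite /of_type cG sG /= andbC eq_sym; case: (eqVneq n _) => [->|]; rewrite ?andbF //= !andbT.
move: tG; rewrite hG; move: #|V| #|external G| (\sum_v _)%N => a x s; lia.
Qed.

Lemma sum_split (m a b : nat) :
  (\sum_(i < m.+1) ((i == a :> nat) && (m - i == b)) = (a + b == m))%N.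
Proof.
case: (eqVneq (a + b)%N m) => [<-|ab].
  rewrite (bigD1 (Ordinal (leq_addr b a : a < (a + b).+1)%N)) //= eqxx addKn eqxx.
  by rewrite big1 // => i /negbTE; rewrite -val_eqE /= => ->.
rewrite big1 // => i _; apply/eqP; rewrite eqb0; apply: contraNN ab.
by have := ltn_ord i; lia.
Qed.

(** Gluing two components by a bridge adds the genera, and uses up one external
    edge on each side. *)
Lemma glue_union_of_type (V1 H1 V2 H2 : finType) (G1 : graph V1 H1)
    (G2 : graph V2 H2) (h1 : H1) (h2 : H2) g n :
  h1 \in external G1 -> h2 \in external G2 ->
  (of_type g n (toggle (union_graph G1 G2) (inl h1) (inr h2)) =
  \sum_(g1 < g.+1) \sum_(n1 < n.+1)
    (of_type g1 n1.+1 G1 && of_type (g - g1) (n - n1).+1 G2) :> nat)%N.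
Proof.
move=> h1E h2E; rewrite {1}/of_type union_toggle_connected // toggle_stable union_stable.
have zero : (forall g' n' g'' n'', of_type g' n' G1 && of_type g'' n'' G2 = false) ->
    (\sum_(g1 < g.+1) \sum_(n1 < n.+1)
      (of_type g1 n1.+1 G1 && of_type (g - g1) (n - n1).+1 G2) = 0)%N.
  by move=> z; apply: big1 => g1 _; apply: big1 => n1 _; rewrite z.
have [c1|nc] := boolP (connected G1); last first.
  by rewrite zero // => *; rewrite /of_type (negbTE nc).
have [c2|nc] := boolP (connected G2); last first.
  by rewrite zero // => *; rewrite /of_type (negbTE nc) andbF.
have [s1|ns] := boolP (stable G1); last first.
  by rewrite zero // => *; rewrite /of_type (negbTE ns) andbF.
have [s2|ns] := boolP (stable G2); last first.
  by rewrite zero // => *; rewrite /of_type (negbTE ns) !andbF.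
have [g1 t1] := of_type_unique c1 s1; have [g2 t2] := of_type_unique c2 s2.
have e1 : (0 < #|external G1|)%N by apply/card_gt0P; exists h1.
have e2 : (0 < #|external G2|)%N by apply/card_gt0P; exists h2.
have := card_external_glue (G := union_graph G1 G2) (c := inl h1) (d := inr h2)
  isT (etrans (union_external_inl _ _ h1) h1E) (etrans (union_external_inr _ _ h2) h2E).
rewrite union_card_external => eE.
(* g1 and g2 are the genera of G1 and G2, so both sums collapse. *)
transitivity ((g1 + g2 == g) && (#|external G1|.-1 + #|external G2|.-1 == n))%N.
  congr nat_of_bool; rewrite !andTb.
  have sE : (\sum_v vgenus (toggle (union_graph G1 G2) (inl h1) (inr h2)) v =
      \sum_v vgenus G1 v + \sum_v vgenus G2 v)%N by rewrite big_sumType.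
  have := t1 g1 #|external G1|; rewrite !eqxx => /and4P[_ _ _ /eqP E1].
  have := t2 g2 #|external G2|; rewrite !eqxx => /and4P[_ _ _ /eqP E2].
  rewrite sE !card_sum; move: e1 e2 eE E1 E2.
  move: (\sum_v vgenus G1 v)%N (\sum_v vgenus G2 v)%N #|external (toggle _ _ _)|.
  move: #|external G1| #|external G2| => x1 x2 a1 a2 x p1 p2 eE E1 E2.
  have [<-|xn] := eqVneq x n; last by apply/esym/negbTE; lia.
  have -> : (x1.-1 + x2.-1 == x)%N by apply/eqP; lia.
  by rewrite andbT andTb; apply/eqP/eqP; lia.
rewrite -mulnb -!sum_split big_distrlr /=; apply: eq_bigr => i _; apply: eq_bigr => j _.
by rewrite t1 t2 mulnb; congr nat_of_bool; lia.
Qed.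

Section UnionSum.
Variables (N : nat).

Lemma total_external g n (V H : finType) : total N g n V H *+ n =
  \sum_(p : lgraph N V H * H) weight (graph_of p.1)
     *+ (of_type g n (graph_of p.1) && (p.2 \in external (graph_of p.1))).
Proof.
rewrite -(pair_bigA _ (fun y h => weight (graph_of y)
     *+ (of_type g n (graph_of y) && (h \in external (graph_of y))))) /=.
rewrite /total -sumrMnl big_mkcond; apply: eq_bigr => y _; rewrite sumrMnr.
case: (boolP (of_type _ _ _)) => [/and4P[_ _ /eqP <- _]|_]; last by rewrite big1.
by congr (_ *+ _); rewrite card_externalE; apply: eq_bigr => h _; rewrite inE.
Qed.

Definition left_vertices (V1 V2 : finType) : {set V1 + V2} := [set inl v | v : V1]%SET.

Lemma inl_left (V1 V2 : finType) v : (inl v \in left_vertices V1 V2) = true.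
Proof. exact: imset_f. Qed.

Lemma inr_left (V1 V2 : finType) v : (inr v \in left_vertices V1 V2) = false.
Proof. by apply/negbTE/imsetP => -[]. Qed.

Lemma separates_union (V1 H1 V2 H2 : finType) (G1 : graph V1 H1)
    (G2 : graph V2 H2) h1 h2 :
  separates (left_vertices V1 V2) (left_vertices H1 H2) (union_graph G1 G2)
    (inl h1) (inr h2).
Proof.
apply/and3P; rewrite inl_left inr_left; split=> //.
by apply/forallP => -[h|h]; rewrite /= ?inl_left ?inr_left.
Qed.

Lemma separates_is_union (V1 H1 V2 H2 : finType)
    (G : graph (V1 + V2)%type (H1 + H2)%type) c d :
  separates (left_vertices V1 V2) (left_vertices H1 H2) G c d ->
  exists G1 : graph V1 H1, exists G2 : graph V2 H2, exists h1, exists h2,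
    [/\ G = union_graph G1 G2, c = inl h1 & d = inr h2].
Proof.
case/and3P => /forallP sG.
case: c => [h1|h1]; rewrite ?inl_left ?inr_left // => _.
case: d => [h2|h2]; rewrite ?inl_left ?inr_left // => _.
have r1E h : exists v, root G (inl h) = inl v.
  have := sG (inl h); rewrite inl_left => /andP[/eqP + _].
  by case: (root G _) => v; rewrite ?inr_left //; exists v.
have r2E h : exists v, root G (inr h) = inr v.
  have := sG (inr h); rewrite inr_left => /andP[/eqP + _].
  by case: (root G _) => v; rewrite ?inl_left //; exists v.
have f1E h : exists h', flip G (inl h) = inl h'.
  have := sG (inl h); rewrite inl_left => /andP[_ /eqP].
  by case: (flip G _) => v; rewrite ?inr_left //; exists v.
have f2E h : exists h', flip G (inr h) = inr h'.
  have := sG (inr h); rewrite inr_left => /andP[_ /eqP].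
  by case: (flip G _) => v; rewrite ?inl_left //; exists v.
have [r1 r1P] := fin_all_exists r1E; have [r2 r2P] := fin_all_exists r2E.
have [f1 f1P] := fin_all_exists f1E; have [f2 f2P] := fin_all_exists f2E.
have f1K : involutive f1.
  by move=> h; have := flipK G (inl h); rewrite !f1P => -[].
have f2K : involutive f2.
  by move=> h; have := flipK G (inr h); rewrite !f2P => -[].
exists (Graph (fun v => vgenus G (inl v)) r1 f1K).
exists (Graph (fun v => vgenus G (inr v)) r2 f2K).
exists h1, h2; split=> //; apply: graph_eq => -[x|x] //=.
Qed.

Lemma glued_sum_union g n (V1 H1 V2 H2 : finType) :
  glued_sum N g n (separates (left_vertices V1 V2) (left_vertices H1 H2)) =
  \sum_(g1 < g.+1) \sum_(n1 < n.+1)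
     (total N g1 n1.+1 V1 H1 *+ n1.+1)
     * (total N (g - g1) (n - n1).+1 V2 H2 *+ (n - n1).+1).
Proof.
pose D := ((lgraph N V1 H1 * H1) * (lgraph N V2 H2 * H2))%type.
pose U (p : D) := union_graph (graph_of p.1.1) (graph_of p.2.1).
pose psi (p : D) : lgraph N (V1 + V2)%type (H1 + H2)%type * ((H1 + H2) * (H1 + H2)) :=
  (lgraph_of N (U p), (inl p.1.2, inr p.2.2)).
have psiE p : graph_of (psi p).1 = U p.
  by apply: lgraph_ofK => -[v|v]; exact: graph_of_bound.
pose ext (p : D) := (p.1.2 \in external (graph_of p.1.1))
                    && (p.2.2 \in external (graph_of p.2.1)).
transitivity (\sum_(p : D | ext p && of_type g n (toggle (U p) (inl p.1.2) (inr p.2.2)))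
    weight (graph_of p.1.1) * weight (graph_of p.2.1)).
  rewrite /glued_sum (@sum_bij _ _ _ _ (fun p : D =>
    ext p && of_type g n (toggle (U p) (inl p.1.2) (inr p.2.2))) _ psi).
  - by apply: eq_bigr => p _; rewrite psiE union_weight.
  - move=> [[y1 h1] [y2 h2]] [[y1' h1'] [y2' h2']] _ _ e.
    have [e1 e2] : h1 = h1' /\ h2 = h2' by case: e.
    have := congr1 (fun p => graph_of p.1) e; rewrite !psiE /U /= => {}e.
    rewrite e1 e2; congr (_, _, (_, _)); apply: graph_of_inj.
      apply: graph_eq => x.
      + exact: (congr1 (fun G => vgenus G (inl x)) e).
      + by have [] := congr1 (fun G => root G (inl x)) e.
      + by have [] := congr1 (fun G => flip G (inl x)) e.
    apply: graph_eq => x.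
    + exact: (congr1 (fun G => vgenus G (inr x)) e).
    + by have [] := congr1 (fun G => root G (inr x)) e.
    + by have [] := congr1 (fun G => flip G (inr x)) e.
  - move=> [[y1 h1] [y2 h2]] /andP[/andP[h1E h2E] yP]; rewrite psiE.
    rewrite [(psi _).2.1]/= [(psi _).2.2]/= yP separates_union andbT.
    rewrite union_external_inl union_external_inr. by move: h1E h2E => /= -> ->.
  - move=> [y [c d]] /and5P[/= cd cE dE yP /separates_is_union[G1 [G2 [h1 [h2 [e ec ed]]]]]].
    have lab1 : graph_of (lgraph_of N G1) = G1.
      apply: lgraph_ofK => v; have := graph_of_bound y (inl v); by rewrite e.
    have lab2 : graph_of (lgraph_of N G2) = G2.
      apply: lgraph_ofK => v; have := graph_of_bound y (inr v); by rewrite e.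
    subst c d; exists ((lgraph_of N G1, h1), (lgraph_of N G2, h2)).
      rewrite /ext /U /= lab1 lab2 -e yP andbT.
      by rewrite -(union_external_inl G1 G2) -(union_external_inr G1 G2) -e cE dE.
    by congr (_, _); apply: graph_of_inj; rewrite psiE /U /= lab1 lab2.
transitivity (\sum_(p : D) \sum_(g1 < g.+1) \sum_(n1 < n.+1)
   weight (graph_of p.1.1) * weight (graph_of p.2.1) *+
    ((of_type g1 n1.+1 (graph_of p.1.1) && (p.1.2 \in external (graph_of p.1.1)))
    * (of_type (g - g1) (n - n1).+1 (graph_of p.2.1)
       && (p.2.2 \in external (graph_of p.2.1))))).
  rewrite big_mkcond; apply: eq_bigr => p _.
  under [RHS]eq_bigr do rewrite sumrMnr.
  rewrite sumrMnr /ext; case: (boolP (_ \in _)) => [h1E|_]; last first.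
    by rewrite big1 // => g1 _; rewrite big1 // => n1 _; rewrite andbF.
  case: (boolP (_ \in _)) => [h2E|_]; last first.
    by rewrite big1 // => g1 _; rewrite big1 // => n1 _; rewrite !andbF muln0.
  under [in RHS]eq_bigr do under eq_bigr do rewrite !andbT mulnb.
  by rewrite -(glue_union_of_type g n h1E h2E) /=; case: (of_type _ _ _).
rewrite exchange_big; apply: eq_bigr => g1 _.
rewrite exchange_big; apply: eq_bigr => n1 _.
rewrite !total_external big_distrlr /= pair_bigA /=; apply: eq_bigr => p _.
by rewrite mulrnAl mulrnAr -mulrnA mulnC.
Qed.
End UnionSum.

(** * Sums over labelled graphs and generating series *)

(** Standardizes a subset of labels and its complement. *)
Lemma split_bij (T : finType) (A : {set T}) (k l : nat) :
  #|A| = k -> #|~: A| = l ->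
  exists2 f : T -> ('I_k + 'I_l)%type, bijective f &
    forall x, (f x \in left_vertices 'I_k 'I_l) = (x \in A).
Proof.
move=> Ak Al; have [||||f bf fA] := @bij_extend T ('I_k + 'I_l)%type
    (enum A) (map inl (enum 'I_k)).
- by rewrite card_sum !card_ord -Ak -Al cardsC.
- exact: enum_uniq.
- by rewrite map_inj_uniq ?enum_uniq //; exact: inl_inj.
- by rewrite size_map -!cardE card_ord.
exists f => // x; have <- : (f x \in map f (enum A)) = (x \in A).
  by rewrite mem_map ?mem_enum //; exact: bij_inj.
rewrite fA; case: (f x) => y; last first.
  by rewrite inr_left; apply/esym/negbTE/mapP => -[].
by rewrite inl_left mem_map ?mem_enum //; exact: inl_inj.
Qed.

Lemma sum_by_card (R : nmodType) (T : finType) (F : nat -> R) :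
  \sum_(A : {set T}) F #|A| = \sum_(i < #|T|.+1) F i *+ 'C(#|T|, i).
Proof.
rewrite (partition_big (fun A : {set T} => inord #|A| : 'I_#|T|.+1) predT) //=.
apply: eq_bigr => i _; rewrite -card_draws -sumr_const.
have E (A : {set T}) : (inord #|A| == i :> 'I_#|T|.+1) = (#|A| == i).
  by rewrite -val_eqE /= inordK // ltnS max_card.
by apply: eq_big => [A|A]; rewrite ?inE E // => /eqP ->.
Qed.

(** A product of two finite sums as a sum over antidiagonals, read off from
    evaluating a product of polynomials at 1. *)
Lemma sum_convolution (R : comNzRingType) (M : nat) (a b : nat -> R) :
  (forall i, (M <= i)%N -> a i = 0) -> (forall i, (M <= i)%N -> b i = 0) ->
  \sum_(v < M + M) \sum_(i < v.+1) a i * b (v - i)%N =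
  (\sum_(i < M) a i) * (\sum_(i < M) b i).
Proof.
move=> a0 b0; pose p := \poly_(i < M) a i; pose q := \poly_(i < M) b i.
have pE i : p`_i = a i by rewrite coef_poly; case: ltnP => // /a0.
have qE i : q`_i = b i by rewrite coef_poly; case: ltnP => // /b0.
have -> : \sum_(i < M) a i = p.[1].
  by rewrite horner_poly; apply: eq_bigr => i _; rewrite expr1n mulr1.
have -> : \sum_(i < M) b i = q.[1].
  by rewrite horner_poly; apply: eq_bigr => i _; rewrite expr1n mulr1.
rewrite -hornerM (@horner_coef_wide _ (M + M)).
  apply: eq_bigr => v _; rewrite expr1n mulr1 coefM.
  by apply: eq_bigr => i _; rewrite pE qE.
apply: leq_trans (size_polyMleq _ _) _.
have sp : (size p <= M)%N := size_poly _ _.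
have sq : (size q <= M)%N := size_poly _ _.
by apply: leq_trans (leq_pred _) _; exact: leq_add.
Qed.

Lemma sum_convolution2 (R : comNzRingType) (M : nat) (a b : nat -> nat -> R) :
  (forall i j, (M <= i)%N || (M <= j)%N -> a i j = 0) ->
  (forall i j, (M <= i)%N || (M <= j)%N -> b i j = 0) ->
  \sum_(v < M + M) \sum_(h < M + M) \sum_(i < v.+1) \sum_(j < h.+1)
    a i j * b (v - i)%N (h - j)%N =
  (\sum_(i < M) \sum_(j < M) a i j) * (\sum_(i < M) \sum_(j < M) b i j).
Proof.
move=> a0 b0.
rewrite -(@sum_convolution _ M (fun i => \sum_(j < M) a i j) (fun i => \sum_(j < M) b i j)).
- apply: eq_bigr => v _; rewrite exchange_big; apply: eq_bigr => i _.
  by rewrite -sum_convolution // => j Mj; [rewrite a0|rewrite b0]; rewrite ?Mj ?orbT.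
- by move=> i Mi; rewrite big1 // => j _; rewrite a0 ?Mi.
- by move=> i Mi; rewrite big1 // => j _; rewrite b0 ?Mi.
Qed.

Lemma exchange_sum4 (R : nmodType) (m n p : nat)
    (F : 'I_p -> nat -> nat -> nat -> nat -> R) :
  \sum_(v < m) \sum_(h < n) \sum_(i < v.+1) \sum_(j < h.+1) \sum_(g < p) F g v h i j =
  \sum_(g < p) \sum_(v < m) \sum_(h < n) \sum_(i < v.+1) \sum_(j < h.+1) F g v h i j.
Proof.
rewrite [RHS]exchange_big; apply: eq_bigr => v _.
rewrite [RHS]exchange_big; apply: eq_bigr => h _.
rewrite [RHS]exchange_big; apply: eq_bigr => i _.
by rewrite [RHS]exchange_big.
Qed.

Section CutFormula.
Variable N : nat.

(** By transport along [split_bij], only the sizes of A and B matter. *)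
Lemma glued_sum_separates g n v h (A : {set 'I_v}) (B : {set 'I_h}) :
  glued_sum N g n (separates A B) =
  \sum_(g1 < g.+1) \sum_(n1 < n.+1)
     (total N g1 n1.+1 'I_#|A| 'I_#|B| *+ n1.+1)
     * (total N (g - g1) (n - n1).+1 'I_(v - #|A|) 'I_(h - #|B|) *+ (n - n1).+1).
Proof.
rewrite -glued_sum_union.
have cardC m (X : {set 'I_m}) : #|~: X| = (m - #|X|)%N.
  by rewrite cardsCs finset.setCK card_ord.
have [f bf fA] := split_bij erefl (cardC v A).
have [k bk kB] := split_bij erefl (cardC h B).
apply: (@glued_sum_iso N g n _ _ _ _ f k) => // G G' [_ [k' kK k'K] _ er ef] c d.
rewrite /separates !kB; congr [&& _, _ & _].
apply/forallP/forallP => s x; first by rewrite -(k'K x) er ef fA !kB; exact: s.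
by have := s (k x); rewrite er ef fA !kB.
Qed.

Lemma total_eq0 g n v h M : (6 * g + 3 * n < M)%N ->
  (M <= v)%N || (M <= h)%N -> total N g n 'I_v 'I_h = 0.
Proof.
move=> gM vh; rewrite /total big1 // => y /of_type_bound[].
by rewrite !card_ord; case/orP: vh; lia.
Qed.

(** The sum of 2 g_v - 2 + val_v > 0 over the vertices is 2g - 2 + n. *)
Lemma total_unstable g n (V H : finType) : (2 * g + n <= 2)%N ->
  total N g n V H = 0.
Proof. by move=> gn; rewrite /total big1 // => y /of_type_stable; lia. Qed.

(** The sum over the sets A and B of labels of the first component produces
    binomial coefficients, which turn the normalization v! h! of the whole graph
    into the product of those of the two components. *)
Lemma chi_cut g n : (6 * g + 3 * n + 6 <= N)%N ->
  d_kappa (chi g n) *+ 2 =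
  (if g is h.+1 then chi h n.+2 else 0) *+ (n.+2 * n.+1)
  + \sum_(g1 < g.+1) \sum_(n1 < n.+1)
      (chi g1 n1.+1 *+ n1.+1) * (chi (g - g1)%N (n - n1).+1 *+ (n - n1).+1).
Proof.
move=> gN; pose M := (6 * g + 3 * n + 7)%N.
rewrite (@chi_total N g n (M + M) (M + M)); [|lia..].
transitivity (\sum_(v < M + M) \sum_(h < M + M) (v`! * h`!)%:R^-1 *:
  (d_kappa (total N g n 'I_v 'I_h) *+ 2)).
  rewrite /d_kappa raddf_sum -sumrMnl; apply: eq_bigr => v _.
  rewrite raddf_sum -sumrMnl; apply: eq_bigr => h _.
  by rewrite /= derivZ scalerMnr.
under eq_bigr do under eq_bigr do
  rewrite d_kappa_total glued_sum_cases glued_sum_connected scalerDr.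
under eq_bigr do rewrite big_split.
rewrite big_split /=; congr (_ + _).
  case: g @M gN => [|g] M gN; last first.
    rewrite (@chi_total N g n.+2 (M + M) (M + M)); [|lia..].
    rewrite -sumrMnl; apply: eq_bigr => v _; rewrite -sumrMnl.
    by apply: eq_bigr => h _; rewrite scalerMnr.
  by rewrite mul0rn big1 // => v _; rewrite big1 // => h _; rewrite ?mul0rn scaler0.
pose u g1 n1 i j : Qtk := (i`! * j`!)%:R^-1 *: (total N g1 n1.+1 'I_i 'I_j *+ n1.+1).
have sum_u g1 n1 : (6 * g1 + 3 * n1.+1 < M)%N ->
    \sum_(i < M) \sum_(j < M) u g1 n1 i j = chi g1 n1.+1 *+ n1.+1.
  move=> gM; rewrite (@chi_total N g1 n1.+1 M M); [|lia..].
  rewrite -sumrMnl; apply: eq_bigr => v _; rewrite -sumrMnl.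
  by apply: eq_bigr => h _; rewrite scalerMnr.
have u0 g1 n1 i j : (6 * g1 + 3 * n1.+1 < M)%N -> (M <= i)%N || (M <= j)%N ->
    u g1 n1 i j = 0.
  by move=> gM ij; rewrite /u (total_eq0 gM ij) mul0rn scaler0.
transitivity (\sum_(v < M + M) \sum_(h < M + M) \sum_(i < v.+1) \sum_(j < h.+1)
    \sum_(g1 < g.+1) \sum_(n1 < n.+1)
      u g1 n1 i j * u (g - g1)%N (n - n1)%N (v - i)%N (h - j)%N).
  apply: eq_bigr => v _; apply: eq_bigr => h _.
  under eq_bigr do under eq_bigr do rewrite glued_sum_separates.
  pose X i j : Qtk := \sum_(g1 < g.+1) \sum_(n1 < n.+1)
     (total N g1 n1.+1 'I_i 'I_j *+ n1.+1)
     * (total N (g - g1) (n - n1).+1 'I_(v - i) 'I_(h - j) *+ (n - n1).+1).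
  rewrite (eq_bigr (fun A : {set 'I_v} => \sum_(j < h.+1) X #|A| j *+ 'C(h, j))); last first.
    by move=> A _; have := sum_by_card 'I_h (X #|A|); rewrite card_ord => <-.
  have := sum_by_card 'I_v (fun i => \sum_(j < h.+1) X i j *+ 'C(h, j)).
  rewrite card_ord => ->.
  rewrite scaler_sumr; apply: eq_bigr => i _; rewrite -sumrMnl scaler_sumr.
  apply: eq_bigr => j _; rewrite -mulrnA.
  have hi : (i <= v)%N by rewrite -ltnS.
  have hj : (j <= h)%N by rewrite -ltnS.
  rewrite (@rescale_mulrn _ ((i`! * j`!) * ((v - i)`! * (h - j)`!))); last 2 first.
  - by rewrite -(bin_fact hi) -(bin_fact hj); lia.
  - by rewrite muln_gt0 !bin_gt0 hi hj.
  rewrite scaler_sumr; apply: eq_bigr => g1 _; rewrite scaler_sumr.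
  by apply: eq_bigr => n1 _; rewrite /u -scalerAl -scalerAr scalerA natrM invfM.
rewrite (exchange_sum4 _ _ (fun (g1 : 'I_g.+1) v h i j => \sum_(n1 < n.+1)
      u g1 n1 i j * u (g - g1)%N (n - n1)%N (v - i)%N (h - j)%N)).
apply: eq_bigr => g1 _.
rewrite (exchange_sum4 _ _ (fun (n1 : 'I_n.+1) v h i j =>
      u g1 n1 i j * u (g - g1)%N (n - n1)%N (v - i)%N (h - j)%N)).
apply: eq_bigr => n1 _.
have hg := ltn_ord g1; have hn := ltn_ord n1.
rewrite -!sum_u; [|lia..].
apply: (sum_convolution2 (a := u g1 n1) (b := u (g - g1)%N (n - n1)%N)) => i j ij.
  by apply: u0 => //; lia.
by apply: u0 => //; lia.
Qed.
End CutFormula.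

(** * The differential equation *)

Lemma chi_unstable g n : (2 * g + n <= 2)%N -> chi g n = 0.
Proof.
move=> gn; have := @chi_total (6 * g + 3 * n) g n (2 * g + n).+1 (6 * g + 3 * n).+1.
rewrite !ltnSn leqnn => -> //; rewrite big1 // => v _; rewrite big1 // => h _.
by rewrite total_unstable ?scaler0.
Qed.

Lemma Dop_chi g n : (2 < 2 * g + n)%N ->
  Dop n (chi g n) = chi g n.+1 *+ n.+1.
Proof. by move=> gn; rewrite (chi_marked (N := 6 * g + 3 * n.+1)). Qed.

(** In the unstable cases both sides are given by the conventions, or vanish. *)
Lemma DchiE g n : Dchi g n = chi g n.+1 *+ n.+1.
Proof.
have [gn|gn] := ltnP 2 (2 * g + n).
  rewrite -Dop_chi //; move: gn; case: g n => [|[|g]] [|[|[|n]]] //=.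
have : [\/ (g = 0 /\ n = 0), (g = 0 /\ n = 1), (g = 0 /\ n = 2) | (g = 1 /\ n = 0)]%N.
  by case: g n gn => [|[|g]] [|[|[|n]]] gn; first
    [by constructor|by constructor 2|by constructor 3|by constructor 4|lia].
by case=> -[-> ->] //=; rewrite chi_unstable // mul0rn.
Qed.

Lemma Dop_mulrn m (p : Qtk) k : Dop m (p *+ k) = Dop m p *+ k.
Proof.
rewrite /Dop /dop !mulrnDl raddfMn /= /d_kappa derivMn.
by rewrite !mulrnAr !scalerMnr.
Qed.

Lemma DDchiE g n : DDchi g n = chi g n.+2 *+ (n.+2 * n.+1).
Proof.
have [->|g0] := eqVneq g 0%N; last first.
  have -> : DDchi g n = Dop n.+1 (Dchi g n) by case: g g0.
  by rewrite DchiE Dop_mulrn Dop_chi ?mulrnA //; lia.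
case: n => [|[|n]] //.
  by rewrite chi_unstable // mul0rn -[LHS]/(Dop 1 (0 *+ 0)) Dop_mulrn.
by rewrite -[LHS]/(Dop n.+3 (Dchi 0 n.+2)) DchiE Dop_mulrn Dop_chi ?mulrnA.
Qed.

Lemma halve (p q : Qtk) : p *+ 2 = q -> p = (1 / 2%:R : Qt) *: q.
Proof.
move=> <-; rewrite -scaler_nat scalerA div1r mulVf ?scale1r //.
by rewrite natQt_eq0.
Qed.

Lemma d_kappa_chi g n : d_kappa (chi g n) =
  (1 / 2%:R : Qt) *:
    ((if g is h.+1 then DDchi h n else 0)
     + \sum_(g1 < g.+1) \sum_(n1 < n.+1)
         Dchi g1 n1 * Dchi (g - g1)%N (n - n1)%N).
Proof.
apply: halve; rewrite (chi_cut (N := 6 * g + 3 * n + 6)) //; congr (_ + _).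
  by case: g => [|h]; rewrite ?mul0rn ?DDchiE.
by apply: eq_bigr => g1 _; apply: eq_bigr => n1 _; rewrite !DchiE.
Qed.

Lemma Dchi0 r : (0 < r)%N -> Dchi r 0 = dchi r.
Proof.
case: r => [|[|r]] // _.
by rewrite -[LHS]/(Dop 0 (chi r.+2 0)) /Dop mul0r scale0r addr0.
Qed.

Theorem theorem3p4 :
  (forall g n : nat, (2 < 2 * g + n)%N ->
     d_kappa (chi g n) =
       (1 / 2%:R : Qt) *:
         ((if g is h.+1 then DDchi h n else 0)
          + \sum_(g1 < g.+1) \sum_(n1 < n.+1)
              Dchi g1 n1 * Dchi (g - g1)%N (n - n1)%N))
  /\
  (forall g : nat, (2 <= g)%N ->
     d_kappa (chi g 0) =
       (1 / 2%:R : Qt) *: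
         (Dop 1 (dchi g.-1) + \sum_(1 <= r < g) dchi r * dchi (g - r)%N)).
Proof.
split=> [g n _|g g2]; rewrite d_kappa_chi //; congr (_ *: (_ + _)).
  case: g g2 => [|[|h]] // _; rewrite -Dchi0 //.
under eq_bigr do rewrite big_ord1 subn0.
rewrite -(big_mkord predT (fun r => Dchi r 0 * Dchi (g - r)%N 0)).
rewrite big_ltn // mul0r add0r big_nat_recr ?(ltnW g2) //= subnn mulr0 addr0.
by apply: eq_big_nat => r /andP[r0 rg]; rewrite !Dchi0 // subn_gt0.
Qed.
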